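(* Let $A\in\mathbb{N}_{\geq 0}^{m\times n}$, $b\in\mathbb{N}_{>0}^m$, $c\in\mathbb{Z}^n$ and a finite set $S=\{x^{(1)},\dots,x^{(k)}\}\subseteq\mathbb{R}^n_{\geq 0}\setminus\{0\}$ generating the cone $C$ be as in the context, and let $N$ be the number of non-zero entries of $A$. Suppose that there is a constant $\hat c>0$ with $c^T x^{(l)}=\hat c$ for all $x^{(l)}\in S$. Given a minimizing oracle $\mathcal{A}$ for $S$ running in $T_\mathcal{A}$ time, for every $\varepsilon\in(0,1)$ a $(1-\varepsilon)$-approximate solution for the problem $\max\{c^Tx : Ax\le b,\ x\in C\}$ can be computed in $\mathcal{O}\left(\frac{1}{\varepsilon^2}\cdot m\log m\cdot (N+T_\mathcal{A})\right)$ time.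
   Context: Setting: $A\in\mathbb{N}_{\geq 0}^{m\times n}$ is a matrix with non-negative integer entries having at least one positive entry in each row and each column; $b\in\mathbb{N}_{>0}^m$ has positive entries; $c\in\mathbb{Z}^n$ has entries of arbitrary sign; $N$ is the number of non-zero entries of $A$. $S=\{x^{(1)},\dots,x^{(k)}\}$ is a finite set of non-zero vectors in $\mathbb{R}^n_{\geq0}$ and $C=\{\sum_{l=1}^k\alpha_l x^{(l)}:\alpha_l\ge0\}$ is the cone it generates; $S$ and $C$ are not given explicitly (the cone is assumed well-described, i.e., encoding length at least $n+1$) but are accessed only through an oracle. A minimizing oracle for $S$ receives a vector $d\in\mathbb{R}^n$ and returns a vector $x^{(l^* )}\in S$ minimizing $d^Tx^{(l)}$ over all $x^{(l)}\in S$; its running time $T_\mathcal{A}$ satisfies $T_\mathcal{A}\in\Omega(n)$. A $(1-\varepsilon)$-approximate solution is a feasible $x$ (i.e. $Ax\le b$, $x\in C$) with $c^Tx\ge(1-\varepsilon)\cdot c^Tx^*$, where $x^*$ is an optimal solution. *)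

(* Defs.v *)
From HB Require Import structures.
From mathcomp Require Import all_boot all_order all_algebra.
From mathcomp Require Import reals exp.

Set Implicit Arguments.
Unset Strict Implicit.
Unset Printing Implicit Defensive.

Import Order.TTheory GRing.Theory Num.Theory.
Local Open Scope ring_scope.

(** * The optimization problem *)

Section Problem.
Variable R : realType.

Definition dot n (u v : 'cV[R]_n) : R := (u^T *m v) 0 0.

Definition natmx m n (A : 'M[nat]_(m, n)) : 'M[R]_(m, n) :=
  map_mx (fun a : nat => a%:R) A.

Definition intmx m n (A : 'M[int]_(m, n)) : 'M[R]_(m, n) :=
  map_mx (fun a : int => a%:~R) A.

(* X lists the generating set S = {x^(1), ..., x^(k)}. *)
Definition cone n k (X : 'I_k -> 'cV[R]_n) (x : 'cV[R]_n) : Prop :=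
  exists2 alpha : 'I_k -> R,
    (forall l, 0 <= alpha l) & x = \sum_(l < k) alpha l *: X l.

Definition feasible m n k (A : 'M[nat]_(m, n)) (b : 'cV[nat]_m)
    (X : 'I_k -> 'cV[R]_n) (x : 'cV[R]_n) : Prop :=
  (forall i, (natmx A *m x) i 0 <= natmx b i 0) /\ cone X x.

Definition optimal m n k (A : 'M[nat]_(m, n)) (b : 'cV[nat]_m)
    (c : 'cV[int]_n) (X : 'I_k -> 'cV[R]_n) (x : 'cV[R]_n) : Prop :=
  feasible A b X x /\
  forall y, feasible A b X y -> dot (intmx c) y <= dot (intmx c) x.

Definition approx_solution m n k (A : 'M[nat]_(m, n)) (b : 'cV[nat]_m)
    (c : 'cV[int]_n) (X : 'I_k -> 'cV[R]_n) (eps : R) (x : 'cV[R]_n) : Prop :=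
  feasible A b X x /\
  exists2 xopt, optimal A b c X xopt &
    (1 - eps) * dot (intmx c) xopt <= dot (intmx c) x.

Definition minimizing_oracle n k (X : 'I_k -> 'cV[R]_n)
    (orc : 'cV[R]_n -> 'cV[R]_n) : Prop :=
  forall d, exists2 l, orc d = X l & forall l', dot d (X l) <= dot d (X l').

(* Equal to log_2 m for m >= 2; the truncation at 1 only affects m = 1, where
   a running time bound proportional to log m would be 0. *)
Definition log2 (m : nat) : R := Num.max 1 (ln m%:R / ln 2%:R).

End Problem.

Definition nnz m n (A : 'M[nat]_(m, n)) : nat :=
  #|[set ij : 'I_m * 'I_n | A ij.1 ij.2 != 0%N]|.

(** * Oracle real RAM

   Programs are finite and contain only natural number constants, so that one
   program works for all dimensions and all data.  The memory consists of
   registers and unbounded arrays, of natural numbers (used as indices) and of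
   real numbers; real arithmetic is exact and has unit cost. *)

Inductive iexp :=
  | INat of nat
  | IReg of nat
  | IGet of nat & iexp
  | IAdd of iexp & iexp
  | ISub of iexp & iexp.

Inductive rexp :=
  | RNat of nat
  | RReg of nat
  | RGet of nat & iexp
  | RAdd of rexp & rexp
  | RSub of rexp & rexp
  | RMul of rexp & rexp
  | RDiv of rexp & rexp.

Inductive bexp :=
  | ILt of iexp & iexp
  | RLt of rexp & rexp
  | BNot of bexp.

Inductive cmd :=
  | Skip
  | ISet of nat & iexp
  | IPut of nat & iexp & iexp
  | RSet of nat & rexp
  | RPut of nat & iexp & rexp
  | CallOracle
  | Seq of cmd & cmd
  | If of bexp & cmd & cmd
  | While of bexp & cmd.

Fixpoint icost (e : iexp) : nat :=
  match e with
  | INat _ | IReg _ => 1%N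
  | IGet _ e1 => (icost e1).+1
  | IAdd e1 e2 | ISub e1 e2 => (icost e1 + icost e2)%N.+1
  end.

Fixpoint rcost (e : rexp) : nat :=
  match e with
  | RNat _ | RReg _ => 1%N
  | RGet _ e1 => (icost e1).+1
  | RAdd e1 e2 | RSub e1 e2 | RMul e1 e2 | RDiv e1 e2 =>
      (rcost e1 + rcost e2)%N.+1
  end.

Fixpoint bcost (e : bexp) : nat :=
  match e with
  | ILt e1 e2 => (icost e1 + icost e2)%N.+1
  | RLt e1 e2 => (rcost e1 + rcost e2)%N.+1
  | BNot e1 => (bcost e1).+1
  end.

(* Numbers of the arrays through which a program communicates. *)
Definition arr_A := 0%N.
Definition arr_b := 1%N.
Definition arr_c := 2%N.
Definition arr_query := 3%N.
Definition arr_answer := 4%N.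
Definition arr_output := 5%N.

Section Machine.
Variable R : realType.

Record state := State {
  ireg : nat -> nat;
  iarr : nat -> nat -> nat;
  rreg : nat -> R;
  rarr : nat -> nat -> R
}.

Definition upd T (f : nat -> T) (i : nat) (v : T) : nat -> T :=
  fun j => if j == i then v else f j.

Definition set_ireg s x v := State (upd (ireg s) x v) (iarr s) (rreg s) (rarr s).
Definition set_iarr s a v := State (ireg s) (upd (iarr s) a v) (rreg s) (rarr s).
Definition set_rreg s x v := State (ireg s) (iarr s) (upd (rreg s) x v) (rarr s).
Definition set_rarr s a v := State (ireg s) (iarr s) (rreg s) (upd (rarr s) a v).

Fixpoint ieval (s : state) (e : iexp) : nat :=
  match e with
  | INat k => k
  | IReg x => ireg s x
  | IGet a e1 => iarr s a (ieval s e1)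
  | IAdd e1 e2 => (ieval s e1 + ieval s e2)%N
  | ISub e1 e2 => (ieval s e1 - ieval s e2)%N
  end.

Fixpoint reval (s : state) (e : rexp) : R :=
  match e with
  | RNat k => k%:R
  | RReg x => rreg s x
  | RGet a e1 => rarr s a (ieval s e1)
  | RAdd e1 e2 => reval s e1 + reval s e2
  | RSub e1 e2 => reval s e1 - reval s e2
  | RMul e1 e2 => reval s e1 * reval s e2
  | RDiv e1 e2 => reval s e1 / reval s e2
  end.

Fixpoint beval (s : state) (e : bexp) : bool :=
  match e with
  | ILt e1 e2 => (ieval s e1 < ieval s e2)%N
  | RLt e1 e2 => reval s e1 < reval s e2
  | BNot e1 => ~~ beval s e1
  end.

Definition read_vec n (f : nat -> R) : 'cV[R]_n := \col_(j < n) f j.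

Definition write_vec n (f : nat -> R) (v : 'cV[R]_n) : nat -> R :=
  fun j => if insub j is Some j' then v j' 0 else f j.

Definition call_oracle n (orc : 'cV[R]_n -> 'cV[R]_n) (s : state) : state :=
  set_rarr s arr_answer
    (write_vec (rarr s arr_answer) (orc (read_vec n (rarr s arr_query)))).

(* exec orc p s s' t q: started in s, the program p terminates in s' after t
   elementary steps and q oracle calls. *)
Inductive exec n (orc : 'cV[R]_n -> 'cV[R]_n) :
    cmd -> state -> state -> nat -> nat -> Prop :=
  | exec_Skip s :
      exec orc Skip s s 1%N 0%N
  | exec_ISet s x e :
      exec orc (ISet x e) s (set_ireg s x (ieval s e)) (icost e).+1 0%N
  | exec_IPut s a i e :
      exec orc (IPut a i e) s
        (set_iarr s a (upd (iarr s a) (ieval s i) (ieval s e)))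
        (icost i + icost e)%N.+1 0%N
  | exec_RSet s x e :
      exec orc (RSet x e) s (set_rreg s x (reval s e)) (rcost e).+1 0%N
  | exec_RPut s a i e :
      exec orc (RPut a i e) s
        (set_rarr s a (upd (rarr s a) (ieval s i) (reval s e)))
        (icost i + rcost e)%N.+1 0%N
  | exec_CallOracle s :
      exec orc CallOracle s (call_oracle orc s) 0%N 1%N
  | exec_Seq p1 p2 s1 s2 s3 t1 q1 t2 q2 :
      exec orc p1 s1 s2 t1 q1 -> exec orc p2 s2 s3 t2 q2 ->
      exec orc (Seq p1 p2) s1 s3 (t1 + t2)%N (q1 + q2)%N
  | exec_If e p1 p2 s s' t q :
      exec orc (if beval s e then p1 else p2) s s' t q ->
      exec orc (If e p1 p2) s s' (bcost e + t)%N q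
  | exec_WhileF e p s :
      ~~ beval s e -> exec orc (While e p) s s (bcost e) 0%N
  | exec_WhileT e p s1 s2 s3 t1 q1 t2 q2 :
      beval s1 e -> exec orc p s1 s2 t1 q1 ->
      exec orc (While e p) s2 s3 t2 q2 ->
      exec orc (While e p) s1 s3 (bcost e + t1 + t2)%N (q1 + q2)%N.

Lemma exec_det n (orc : 'cV[R]_n -> 'cV[R]_n) p s s1 t1 q1 s2 t2 q2 :
  exec orc p s s1 t1 q1 -> exec orc p s s2 t2 q2 ->
  [/\ s1 = s2, t1 = t2 & q1 = q2].
Proof.
move=> H; elim: H s2 t2 q2 => {p s s1 t1 q1};
  try by [move=> > H; inversion H].
- move=> > _ IH1 _ IH2 > H; inversion H; subst.
  match goal with H1 : exec _ _ _ _ _ _, H2 : exec _ _ _ _ _ _ |- _ =>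
    have [? ? ?] := IH1 _ _ _ H1; subst; by have [-> -> ->] := IH2 _ _ _ H2 end.
- move=> > _ IH > H; inversion H; subst.
  match goal with H1 : exec _ (if _ then _ else _) _ _ _ _ |- _ =>
    by have [-> -> ->] := IH _ _ _ H1 end.
- move=> > /negbTE He > H; inversion H; subst => //; congruence.
- move=> > He _ IH1 _ IH2 > H; inversion H; subst.
    by match goal with H1 : is_true (~~ _) |- _ => rewrite He in H1 end.
  match goal with H1 : exec _ _ _ _ _ _, H2 : exec _ (While _ _) _ _ _ _ |- _ =>
    have [? ? ?] := IH1 _ _ _ H1; subst; by have [-> -> ->] := IH2 _ _ _ H2 end.
Qed.

(* The matrix A is stored densely in row-major order.  Neither S nor T_A is
   part of the input, and memory not mentioned here has arbitrary contents. *)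
Definition input_state m n (A : 'M[nat]_(m, n)) (b : 'cV[nat]_m)
    (c : 'cV[int]_n) (eps : R) (s : state) : Prop :=
  [/\ ireg s 0%N = m /\ ireg s 1%N = n,
      rreg s 0%N = eps,
      forall (i : 'I_m) (j : 'I_n), rarr s arr_A (i * n + j)%N = (A i j)%:R,
      forall i : 'I_m, rarr s arr_b i = (b i 0)%:R
    & forall j : 'I_n, rarr s arr_c j = (c j 0)%:~R].

Definition output n (s : state) : 'cV[R]_n := read_vec n (rarr s arr_output).

(* TA is the time of a single oracle call; it covers the transfer of the query
   and of the answer. *)
Definition running_time (TA : R) (t q : nat) : R := t%:R + q%:R * TA.

End Machine.

(* Main.v *)
Require Import Defs.
From HB Require Import structures.
From mathcomp Require Import all_boot all_order all_algebra.
From mathcomp Require Import reals exp.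
From mathcomp Require Import zify ring lra.
From mathcomp Require Import classical_sets topology normedtype sequences derive.

Set Implicit Arguments.
Unset Strict Implicit.
Unset Printing Implicit Defensive.

Import Order.TTheory GRing.Theory Num.Theory.
Import numFieldNormedType.Exports.
Local Open Scope ring_scope.

(* Since all generators have the same objective value, the task is to maximize
   sum_l alpha_l subject to sum_l alpha_l (A x^(l))_i / b_i <= 1, a packing
   problem, solved by multiplicative weights.  Each row i has a weight w_i; the
   oracle, asked with the prices A^T (w_i / b_i)_i, returns a cheapest
   generator z, which is added with the largest coefficient 1/M,
   M = max_i (A z)_i / b_i, that raises no row load L_i by more than 1; then w_i
   is multiplied by 1 + (eps/2) (A z)_i / (b_i M).  By weak duality, the ratio
   Z / W of the price of z to the total weight satisfies
   (Z / W) * sum_l alpha_l <= 1 for every feasible alpha.  With v the sum of the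
   coefficients so far, rho the largest ratio seen and lam the largest load, the
   scaled point x / lam is feasible of value v / lam, and it is
   (1 - eps)-approximate as soon as (1 - eps) lam < v rho; this test needs no
   logarithm.  For the number T of iterations, e := eps/2 and
     exp (e (1 - e) L_i) <= w_i <= sum_i w_i <= m exp (e v rho)
   give eps^2 lam <= 4 ln m while the test fails, whereas every iteration raises
   some load by 1, so that T <= m lam.  Working on a list of the nonzero entries
   of A makes an iteration cost O(N) plus one oracle call. *)

(** * A program logic for the oracle real RAM *)

(** An array counts as a single location, so that write sets can be read off the syntax; facts about
    individual cells go into loop invariants instead. *)
Variant loc := LIreg of nat | LIarr of nat | LRreg of nat | LRarr of nat.

Definition loc_code (l : loc) : nat * nat :=
  match l with
  | LIreg x => (0, x) | LIarr x => (1, x) | LRreg x => (2, x) | LRarr x => (3, x)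
  end%N.

Definition loc_decode (c : nat * nat) : loc :=
  match c.1 with
  | 0 => LIreg c.2 | 1 => LIarr c.2 | 2 => LRreg c.2 | _ => LRarr c.2
  end%N.

Lemma loc_codeK : cancel loc_code loc_decode.
Proof. by case. Qed.

HB.instance Definition _ := Equality.copy loc (can_type loc_codeK).

Fixpoint writes (p : cmd) : seq loc :=
  match p with
  | Skip => [::]
  | ISet x _ => [:: LIreg x]
  | IPut a _ _ => [:: LIarr a]
  | RSet x _ => [:: LRreg x]
  | RPut a _ _ => [:: LRarr a]
  | CallOracle => [:: LRarr arr_answer]
  | Seq p1 p2 | If _ p1 p2 => writes p1 ++ writes p2
  | While _ p1 => writes p1
  end.

Fixpoint loop_free (p : cmd) : bool :=
  match p with
  | Seq p1 p2 | If _ p1 p2 => loop_free p1 && loop_free p2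
  | While _ _ | CallOracle => false
  | _ => true
  end.

(** A worst-case count, taking the dearer branch of a conditional. The value 0 for loops and oracle
    calls is a placeholder, excluded by [loop_free] where it matters. *)
Fixpoint cost (p : cmd) : nat :=
  match p with
  | Skip => 1
  | ISet _ e => (icost e).+1
  | IPut _ i e => (icost i + icost e).+1
  | RSet _ e => (rcost e).+1
  | RPut _ i e => (icost i + rcost e).+1
  | Seq p1 p2 => cost p1 + cost p2
  | If e p1 p2 => bcost e + maxn (cost p1) (cost p2)
  | While _ _ | CallOracle => 0
  end%N.

Definition For (x y : nat) (p : cmd) : cmd :=
  Seq (ISet x (INat 0))
    (While (ILt (IReg x) (IReg y))
       (Seq p (ISet x (IAdd (IReg x) (INat 1))))).

Section ProgramLogic.
Variable R : realType.
Implicit Types (s : state R) (p : cmd) (W : seq loc).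

(* Meaningful for loop-free programs only. *)
Fixpoint run p s : state R :=
  match p with
  | ISet x e => set_ireg s x (ieval s e)
  | IPut a i e => set_iarr s a (upd (iarr s a) (ieval s i) (ieval s e))
  | RSet x e => set_rreg s x (reval s e)
  | RPut a i e => set_rarr s a (upd (rarr s a) (ieval s i) (reval s e))
  | Seq p1 p2 => run p2 (run p1 s)
  | If e p1 p2 => if beval s e then run p1 s else run p2 s
  | Skip | While _ _ | CallOracle => s
  end.

Definition agree_off W s s' : Prop :=
  [/\ forall x, LIreg x \notin W -> ireg s' x = ireg s x,
      forall x, LIarr x \notin W -> iarr s' x = iarr s x,
      forall x, LRreg x \notin W -> rreg s' x = rreg s x
    & forall x, LRarr x \notin W -> rarr s' x = rarr s x].

Lemma agree_off_refl W s : agree_off W s s.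
Proof. by []. Qed.

Lemma agree_off_trans W s1 s2 s3 :
  agree_off W s1 s2 -> agree_off W s2 s3 -> agree_off W s1 s3.
Proof.
move=> [i1 a1 r1 q1] [i2 a2 r2 q2].
by split=> x xW; rewrite (i2, a2, r2, q2) // (i1, a1, r1, q1).
Qed.

Lemma agree_off_sub W W' s1 s2 :
  {subset W <= W'} -> agree_off W s1 s2 -> agree_off W' s1 s2.
Proof.
move=> sub [i1 a1 r1 q1].
by split=> x xW; rewrite (i1, a1, r1, q1) //; apply: contra xW; apply: sub.
Qed.

(** * Frame property and proof rules for time-bounded triples *)

Variables (n : nat) (orc : 'cV[R]_n -> 'cV[R]_n).

Lemma exec_agree_off p s s' t q :
  exec orc p s s' t q -> agree_off (writes p) s s'.
Proof.
elim=> {p s s' t q} /=.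
- by move=> s; exact: agree_off_refl.
- by move=> s x e; split=> y //= yW; rewrite /upd; case: eqP yW => [->|//]; rewrite inE eqxx.
- by move=> s a i e; split=> y //= yW; rewrite /upd; case: eqP yW => [->|//]; rewrite inE eqxx.
- by move=> s x e; split=> y //= yW; rewrite /upd; case: eqP yW => [->|//]; rewrite inE eqxx.
- by move=> s a i e; split=> y //= yW; rewrite /upd; case: eqP yW => [->|//]; rewrite inE eqxx.
- by move=> s; split=> y //= yW; rewrite /upd; case: eqP yW => [->|//]; rewrite inE eqxx.
- move=> p1 p2 s1 s2 s3 t1 q1 t2 q2 _ H1 _ H2.
  by apply: agree_off_trans (agree_off_sub _ H1) (agree_off_sub _ H2) => l;
    rewrite mem_cat => ->; rewrite ?orbT.
- move=> e p1 p2 s s' t q _; case: (beval s e); apply: agree_off_sub => l;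
    by rewrite mem_cat => ->; rewrite ?orbT.
- by move=> e p s _; exact: agree_off_refl.
- move=> e p s1 s2 s3 t1 q1 t2 q2 _ _ H1 _ H2.
  exact: agree_off_trans H1 H2.
Qed.

(** A total-correctness triple in which [t] is only an upper bound on the elementary steps, while
    [q] is the exact number of oracle calls. *)
Definition runs p s (t q : nat) (Q : state R -> Prop) : Prop :=
  exists s' t', [/\ exec orc p s s' t' q, (t' <= t)%N & Q s'].

(** The consequence rule with framing built in: the implication between postconditions may use that
    everything outside the write set is unchanged. *)
Lemma runs_weaken p s t t' q (Q Q' : state R -> Prop) :
  runs p s t q Q -> (t <= t')%N ->
  (forall s', agree_off (writes p) s s' -> Q s' -> Q' s') -> runs p s t' q Q'.
Proof.
move=> [s' [u [e tu Qs]]] tt' QQ'; exists s', u; split=> //.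
  exact: leq_trans tt'.
exact: QQ' (exec_agree_off e) Qs.
Qed.

Lemma runs_seq p1 p2 s t1 t2 q1 q2 (Q : state R -> Prop) :
  runs p1 s t1 q1 (fun s' => runs p2 s' t2 q2 Q) ->
  runs (Seq p1 p2) s (t1 + t2) (q1 + q2) Q.
Proof.
move=> [s1 [u1 [e1 tu1 [s2 [u2 [e2 tu2 Qs]]]]]].
exists s2, (u1 + u2)%N; split=> //; last exact: leq_add.
exact: exec_Seq e1 e2.
Qed.

Lemma runs_loop_free p s (Q : state R -> Prop) :
  loop_free p -> Q (run p s) -> runs p s (cost p) 0 Q.
Proof.
move=> lf Qs; suff [t [e le]] : exists t, exec orc p s (run p s) t 0 /\ (t <= cost p)%N.
  by exists (run p s), t.
elim: p s lf {Q Qs} => //=.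
- by move=> s _; exists 1%N; split=> //; constructor.
- by move=> x e s _; eexists; split; first constructor.
- by move=> x i e s _; eexists; split; first constructor.
- by move=> x e s _; eexists; split; first constructor.
- by move=> x i e s _; eexists; split; first constructor.
- move=> p1 IH1 p2 IH2 s /andP[/IH1 H1 /IH2 H2].
  have [t1 [e1 l1]] := H1 s; have [t2 [e2 l2]] := H2 (run p1 s).
  by exists (t1 + t2)%N; split; [exact: (exec_Seq e1 e2) | exact: leq_add].
- move=> e p1 IH1 p2 IH2 s /andP[/IH1 H1 /IH2 H2].
  have [t [ex le]] : exists t,
      exec orc (if beval s e then p1 else p2) s (run (If e p1 p2) s) t 0 /\
      (t <= maxn (cost p1) (cost p2))%N.
    rewrite /=; case: (beval s e).
      have [t [ex le]] := H1 s; exists t; split=> //.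
      by rewrite leq_max le.
    have [t [ex le]] := H2 s; exists t; split=> //.
    by rewrite leq_max le orbT.
  exists (bcost e + t)%N; split; last by rewrite leq_add2l.
  exact: exec_If ex.
Qed.

(** Each pass adds 3 for the test and 4 for the increment, hence [c + 7]; the initialization costs 2
    and the failing last test 3, hence the 5. *)
Lemma runs_for x y p s0 c (I : nat -> state R -> Prop) :
  x != y -> LIreg x \notin writes p -> LIreg y \notin writes p ->
  I 0%N (set_ireg s0 x 0) ->
  (forall k s, (k < ireg s0 y)%N -> ireg s x = k ->
     agree_off (LIreg x :: writes p) s0 s -> I k s ->
     runs p s c 0 (fun s' => I k.+1 (set_ireg s' x k.+1))) ->
  runs (For x y p) s0 (5 + ireg s0 y * (c + 7)) 0 (I (ireg s0 y)).
Proof.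
move=> xy xp yp I0 IS; set b := ireg s0 y.
pose W := While (ILt (IReg x) (IReg y)) (Seq p (ISet x (IAdd (IReg x) (INat 1)))).
(* Induction on the number [d] of passes that are left. *)
have loop d k s : (k + d)%N = b -> ireg s x = k ->
    agree_off (LIreg x :: writes p) s0 s -> I k s ->
    runs W s (3 + d * (c + 7)) 0 (I b).
  elim: d k s => [|d IHd] k s.
    rewrite addn0 => -> sx fr Ib; exists s, 3%N; split=> //.
    apply: exec_WhileF => /=; rewrite sx.
    by case: fr => -> //; rewrite ?ltnn // inE negb_or yp andbT eq_sym.
  move=> kd sx fr Ik.
  have kb : (k < b)%N by rewrite -kd addnS ltnS leq_addr.
  have sy : ireg s y = b.
    by case: fr => -> //; rewrite inE negb_or yp andbT eq_sym.
  have [s1 [t1 [e1 l1 I1]]] := IS k s kb sx fr Ik.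
  have [f1 f2 f3 f4] := exec_agree_off e1.
  have s1x : ireg s1 x = k by rewrite f1.
  set s2 := set_ireg s1 x k.+1 in I1.
  have fr2 : agree_off (LIreg x :: writes p) s0 s2.
    apply: agree_off_trans fr _; split=> z /=; rewrite inE negb_or => /andP[zx zp];
      [|exact: f2|exact: f3|exact: f4].
    by rewrite /upd; case: (z =P x) zx => [->|_ _]; [rewrite eqxx | exact: f1].
  have [||//|//|s3 [t3 [e3 l3 I3]]] := IHd k.+1 s2; first by rewrite addSn -addnS.
    by rewrite /= /upd eqxx.
  exists s3, (3 + (t1 + 4) + t3)%N; split=> //.
    apply: (exec_WhileT (e := ILt (IReg x) (IReg y)) (s2 := s2) (q1 := 0%N)) e3.
      by rewrite /= sx sy.
    have -> : s2 = set_ireg s1 x (ieval s1 (IAdd (IReg x) (INat 1))).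
      by rewrite /= s1x addn1.
    exact: (exec_Seq e1 (exec_ISet _ _ _ _)).
  by rewrite mulSn; lia.
have sx0 : ireg (set_ireg s0 x 0) x = 0%N by rewrite /= /upd eqxx.
have fr0 : agree_off (LIreg x :: writes p) s0 (set_ireg s0 x 0).
  split=> z //=; rewrite inE negb_or => /andP[zx _]; rewrite /upd.
  by case: (z =P x) zx => [->|//]; rewrite eqxx.
have [s3 [t3 [e3 l3 I3]]] := loop b 0%N _ (add0n _) sx0 fr0 I0.
exists s3, (2 + t3)%N; split=> //.
by have := exec_Seq (exec_ISet orc s0 x (INat 0)) e3.
Qed.

(** Termination comes from the body hypothesis, by which an open guard forces [T < B]. One and the
    same [T] counts the passes in the time bound and the oracle calls, one per pass. *)
Lemma runs_while e p s0 c B (J : nat -> state R -> Prop) :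
  J 0%N s0 ->
  (forall T s, J T s -> beval s e ->
     (T < B)%N /\ runs p s c 1 (J T.+1)) ->
  exists2 T, (T <= B)%N &
    runs (While e p) s0 (bcost e + T * (bcost e + c)) T
      (fun s => J T s /\ ~~ beval s e).
Proof.
move=> J0 JS.
have loop d T s : (T + d)%N = B -> J T s ->
    exists2 d', (d' <= d)%N & runs (While e p) s (bcost e + d' * (bcost e + c)) d'
      (fun s => J (T + d')%N s /\ ~~ beval s e).
  elim: d T s => [|d IHd] T s Td JT; case: (boolP (beval s e)) => es.
  - by have [] := JS T s JT es; rewrite -Td addn0 ltnn.
  - exists 0%N => //; exists s, (bcost e); split=> //; first exact: exec_WhileF.
      by rewrite mul0n addn0.
    by rewrite addn0.
  - have [_ [s1 [t1 [e1 l1 J1]]]] := JS T s JT es.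
    have [|d' dd' [s2 [t2 [e2 l2 J2]]]] := IHd T.+1 s1 _ J1; first by rewrite addSnnS.
    exists d'.+1 => //; exists s2, (bcost e + t1 + t2)%N; split.
    + exact: (exec_WhileT es e1 e2).
    + by rewrite mulSn addnCA leq_add // leq_add2l.
    + by rewrite -addSnnS.
  - exists 0%N => //; exists s, (bcost e); split=> //; first exact: exec_WhileF.
      by rewrite mul0n addn0.
    by rewrite addn0.
have [d dB H] := loop B 0%N s0 (add0n _) J0.
by exists d.
Qed.

Lemma runs_then p1 p2 s t1 t q (Q1 Q : state R -> Prop) :
  runs p1 s t1 0 Q1 -> (t1 <= t)%N ->
  (forall s', agree_off (writes p1) s s' -> Q1 s' ->
     runs p2 s' (t - t1) q Q) ->
  runs (Seq p1 p2) s t q Q.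
Proof.
move=> H1 le H2; rewrite -(subnKC le); apply: (runs_seq (q1 := 0)).
exact: runs_weaken H1 (leqnn _) H2.
Qed.

Lemma runs_oracle p s t q (Q : state R -> Prop) :
  runs p (call_oracle orc s) t q Q -> runs (Seq CallOracle p) s t q.+1 Q.
Proof.
move=> H; apply: (runs_seq (t1 := 0) (q1 := 1)).
by exists (call_oracle orc s), 0%N; split=> //; exact: exec_CallOracle.
Qed.

Lemma runs_for_loop_free x y p s0 b t (I : nat -> state R -> Prop) :
  x != y -> LIreg x \notin writes p -> LIreg y \notin writes p -> loop_free p ->
  ireg s0 y = b -> (5 + b * (cost p + 7) <= t)%N ->
  I 0%N (set_ireg s0 x 0) ->
  (forall k s, (k < b)%N -> ireg s x = k ->
     agree_off (LIreg x :: writes p) s0 s -> I k s ->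
     I k.+1 (set_ireg (run p s) x k.+1)) ->
  runs (For x y p) s0 t 0 (I b).
Proof.
move=> xy xp yp lf <- le I0 IS.
apply: runs_weaken (runs_for (c := cost p) (I := I) xy xp yp I0 _) le _ => //.
by move=> k s kb sx F Ik; apply: runs_loop_free => //; exact: IS.
Qed.

End ProgramLogic.

(** * Multiplicative weights for the packing problem *)

Section Packing.
Variables (R : realType) (m n k : nat).
Variables (A : 'M[nat]_(m, n)) (b : 'cV[nat]_m) (X : 'I_k -> 'cV[R]_n).
Hypothesis A_col : forall j, exists i, (0 < A i j)%N.
Hypothesis b_gt0 : forall i, (0 < b i ord0)%N.
Hypothesis X_ge0 : forall l, (forall j, 0 <= X l j 0) /\ X l <> 0.

Lemma dotE (u v : 'cV[R]_n) : dot u v = \sum_j u j 0 * v j 0.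
Proof. by rewrite /dot mxE; apply: eq_bigr => j _; rewrite mxE. Qed.

Lemma dot_sumr (u : 'cV[R]_n) (alpha : 'I_k -> R) :
  dot u (\sum_l alpha l *: X l) = \sum_l alpha l * dot u (X l).
Proof.
rewrite /dot mulmx_sumr summxE; apply: eq_bigr => l _.
by rewrite -scalemxAr mxE.
Qed.

(** Dividing each row by its capacity gives a packing problem with unit capacities. *)
Definition usage (x : 'cV[R]_n) (i : 'I_m) : R :=
  (natmx R A *m x) i 0 / (b i 0)%:R.

Lemma usageE x i :
  usage x i = \sum_j (A i j)%:R * x j 0 / (b i 0)%:R.
Proof.
rewrite /usage mxE mulr_suml; apply: eq_bigr => j _.
by rewrite mxE.
Qed.

Lemma usage_le1 x i :
  ((natmx R A *m x) i 0 <= natmx R b i 0) = (usage x i <= 1).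
Proof. by rewrite /usage ler_pdivrMr ?mul1r ?ltr0n // [natmx R b i 0]mxE. Qed.

Lemma usage_sum (alpha : 'I_k -> R) i :
  usage (\sum_l alpha l *: X l) i = \sum_l alpha l * usage (X l) i.
Proof.
rewrite /usage mulmx_sumr summxE mulr_suml; apply: eq_bigr => l _.
by rewrite -scalemxAr mxE mulrA.
Qed.

Lemma usageD x y i : usage (x + y) i = usage x i + usage y i.
Proof. by rewrite /usage mulmxDr mxE mulrDl. Qed.

Lemma usageZ t x i : usage (t *: x) i = t * usage x i.
Proof. by rewrite /usage -scalemxAr mxE mulrA. Qed.

Lemma usage_ge0 l i : 0 <= usage (X l) i.
Proof.
rewrite usageE; apply: sumr_ge0 => j _.
by rewrite divr_ge0 ?mulr_ge0 ?ler0n //; case: (X_ge0 l).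
Qed.

(** A non-zero generator has a positive coordinate, and that column of [A] has a positive entry.
    This makes the step length 1/M meaningful and the set of feasible coefficients bounded. *)
Lemma usage_gt0 l : exists i, 0 < usage (X l) i.
Proof.
have [X0 Xn0] := X_ge0 l.
have [j Xj] : exists j, 0 < X l j 0.
  apply/existsP; apply: contra_notT Xn0 => /existsPn H.
  apply/matrixP => j j'; rewrite (ord1 j') [RHS]mxE; apply/eqP.
  by have := X0 j; rewrite le_eqVlt (negbTE (H j)) orbF eq_sym.
have [i Aij] := A_col j; exists i.
rewrite usageE (bigD1 j) //= ltr_pwDl //.
  by rewrite divr_gt0 ?mulr_gt0 ?ltr0n.
by apply: sumr_ge0 => j' _; rewrite divr_ge0 ?mulr_ge0 ?ler0n.
Qed.

(** The extreme value theorem in coefficient space: the objective is linear, the constraints are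
    closed, and feasible coefficients lie in a compact box because every generator loads some
    row. *)
Lemma optimal_exists (c : 'cV[int]_n) : exists x, optimal A b c X x.
Proof.
pose comb (u : 'rV[R]_k) := \sum_l u 0 l *: X l.
(* Feasibility bounds the coefficient of [X l] by the inverse usage of any row that it loads.
   Summing over all rows avoids choosing one; rows of usage 0 contribute [0^-1 = 0]. *)
pose bound l : R := \sum_i (usage (X l) i)^-1.
pose box := [set u : 'rV[R]_k | forall l, `[0, bound l]%classic (u ord0 l)]%classic.
pose F := [set u : 'rV[R]_k | forall i, usage (comb u) i <= 1]%classic.
have coordC l : continuous (fun u : 'rV[R]_k => u 0 l) by exact: coord_continuous.
have termC l (r : R) : continuous (fun u : 'rV[R]_k => u 0 l * r).
  by move=> u; apply: continuousM; [exact: coordC | exact: cst_continuous].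
have linC (g : 'I_k -> R) : continuous (fun u : 'rV[R]_k => \sum_l u 0 l * g l).
  by apply: continuous_big => [|l _]; [exact: add_continuous | exact: termC].
have usageC i : continuous (fun u : 'rV[R]_k => usage (comb u) i).
  have -> : (fun u : 'rV[R]_k => usage (comb u) i) =
            fun u => \sum_l u 0 l * usage (X l) i.
    by apply: boolp.funext => u; rewrite usage_sum.
  exact: linC.
have cK : compact (box `&` F)%classic.
  apply: compact_closedI.
    apply: (@rV_compact _ _ (fun l => `[0, bound l]%classic)) => l.
    exact: segment_compact.
  have -> : F = (\bigcap_i [set u | usage (comb u) i <= 1])%classic.
    by apply/seteqP; split=> u Fu i //=; apply: Fu.
  apply: closed_bigI => i _.
  apply: (@closed_comp _ _ _ [set x : R | x <= 1]%classic) (@closed_le _ _).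
  by move=> u _; exact: usageC.
have K0 : (box `&` F)%classic 0.
  have comb0 : comb 0 = 0.
    by apply: big1 => l _; rewrite mxE scale0r.
  split=> [l /=|i /=]; last by rewrite comb0 /usage mulmx0 mxE mul0r.
  rewrite mxE in_itv /= lexx; apply: sumr_ge0 => i _.
  by rewrite invr_ge0 usage_ge0.
have [|u /set_mem[Bu Fu] umax] :=
  compact_EVT_max (f := fun u => dot (intmx R c) (comb u)) (ex_intro _ 0 K0) cK.
  apply: continuous_subspaceT.
  have -> : (fun u => dot (intmx R c) (comb u)) =
            fun u => \sum_l u 0 l * dot (intmx R c) (X l).
    by apply: boolp.funext => u; rewrite dot_sumr.
  exact: linC.
exists (comb u); split.
  split=> [i|]; first by rewrite usage_le1; exact: Fu.
  by exists (fun l => u 0 l) => // l; have := Bu l; rewrite /= in_itv => /andP[].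
(* It remains to place the coefficients of an arbitrary feasible point in the box. *)
move=> y [yb [alpha alpha0 yE]].
pose v : 'rV[R]_k := \row_l alpha l.
have yv : y = comb v by rewrite yE; apply: eq_bigr => l _; rewrite mxE.
rewrite yv; apply: umax; apply/mem_set; split=> [l|i]; last first.
  by rewrite /= -yv -usage_le1.
rewrite /= mxE in_itv /= alpha0 /=.
have [i ui] := usage_gt0 l.
have : usage y i <= 1 by rewrite -usage_le1.
rewrite yE usage_sum (bigD1 l) //= => le1.
apply: (@le_trans _ _ (usage (X l) i)^-1).
  rewrite -div1r ler_pdivlMr //; apply: le_trans le1; rewrite lerDl.
  by apply: sumr_ge0 => l' _; rewrite mulr_ge0 ?usage_ge0.
rewrite /bound (bigD1 i) //= lerDl.
by apply: sumr_ge0 => i' _; rewrite invr_ge0 usage_ge0.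
Qed.


(** * Multiplicative weights: invariant, step, iteration bound and approximation guarantee *)

Variable eps : R.
Hypothesis eps01 : 0 < eps < 1.

Let e : R := eps / 2%:R.

Let e01 : 0 < e < 1.
Proof. by have /andP[? ?] := eps01; apply/andP; rewrite /e; split; lra. Qed.

(* v is the coefficient sum of x, rho a lower bound on the reciprocal of the
   optimal coefficient sum, lam an upper bound on the loads L. *)
Record mwu_inv (T : nat) (w L : 'I_m -> R) (x : 'cV[R]_n) (v rho lam : R) :
    Prop := MwuInv {
  inv_weight : forall i, expR (e * (1 - e) * L i) <= w i;
  inv_total : \sum_i w i <= m%:R * expR (e * (v * rho));
  inv_load : forall i, L i <= lam;
  inv_lam : e * (1 - e) * lam <= ln m%:R + e * (v * rho);
  inv_iter : T%:R <= \sum_i L i;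
  inv_rho : 0 <= rho;
  inv_dual : forall alpha : 'I_k -> R, (forall l, 0 <= alpha l) ->
    (forall i, usage (\sum_l alpha l *: X l) i <= 1) ->
    rho * \sum_l alpha l <= 1;
  inv_cone : exists2 alpha : 'I_k -> R, (forall l, 0 <= alpha l) &
    x = \sum_l alpha l *: X l /\ v = \sum_l alpha l;
  inv_usage : forall i, usage x i = L i
}.

Lemma mwu_inv0 : (0 < m)%N ->
  mwu_inv 0 (fun=> 1) (fun=> 0) 0 0 0 0.
Proof.
move=> m0; split=> //.
- by move=> i; rewrite mulr0 expR0.
- by rewrite sumr_const card_ord mul0r mulr0 expR0 mulr1.
- by rewrite mul0r !mulr0 addr0 ln_ge0 // ler1n.
- by rewrite big1.
- by move=> alpha _ _; rewrite mul0r.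
- exists (fun=> 0) => //; split; last by rewrite big1.
  by rewrite big1 // => l _; rewrite scale0r.
- by move=> i; rewrite /usage mulmx0 mxE mul0r.
Qed.

(** With [y = e * t], the inequality [ln (1 + z) <= z] at [z = - y / (1 + y)] gives
    [y / (1 + y) <= ln (1 + y)], and [(1 - e) * (1 + y) <= 1] because [t <= 1]. It turns the
    multiplicative updates into an exponential lower bound on the weights. *)
Lemma le_expR1D (t : R) : 0 <= t <= 1 -> expR (e * (1 - e) * t) <= 1 + e * t.
Proof.
move=> /andP[t0 t1]; have /andP[e0 e1] := e01.
have et0 : 0 <= e * t by rewrite mulr_ge0 // ltW.
have D0 : 0 < 1 + e * t by rewrite ltr_pwDl.
have -> : 1 + e * t = expR (ln (1 + e * t)) by rewrite lnK ?posrE.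
rewrite ler_expR -[leRHS]opprK -lnV ?posrE // lerNr.
have -> : (1 + e * t)^-1 = 1 + (- (e * t / (1 + e * t))).
  by field; rewrite gt_eqF.
apply: le_trans (le_ln1Dx _) _.
  by rewrite ltrN2 ltr_pdivrMr // mul1r; lra.
rewrite lerN2 ler_pdivlMr //.
suff : 0 <= e * t * (e - e * t + e * (e * t)) by lra.
rewrite mulr_ge0 //; nra.
Qed.

(** The new data are given by equations, so that the contents of registers and arrays can be plugged
    in directly. For [lam'] it suffices to be a bound on the new loads that is the old bound or one
    of these loads, as a running maximum is. *)
Lemma mwu_step T w L x v rho lam l a M w' L' v' rho' lam' :
  mwu_inv T w L x v rho lam ->
  (forall l', dot (\col_j \sum_i (A i j)%:R * (w i / (b i 0)%:R)) (X l) <=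
              dot (\col_j \sum_i (A i j)%:R * (w i / (b i 0)%:R)) (X l')) ->
  (forall i, a i = usage (X l) i) ->
  (forall i, a i <= M) -> (exists i, a i = M) ->
  (forall i, w' i = w i * (1 + e * (a i / M))) ->
  (forall i, L' i = L i + a i / M) ->
  v' = v + M^-1 ->
  rho' = Num.max rho ((\sum_i w i * a i) / \sum_i w i) ->
  (forall i, L' i <= lam') ->
  lam' = lam \/ (exists i, lam' = L' i) ->
  mwu_inv T.+1 w' L' (x + M^-1 *: X l) v' rho' lam'.
Proof.
move=> [iw iW iL ilam iT irho idual [alpha alpha0 [xE vE]] iu].
move=> lmin aE aM [i0 ai0] w'E L'E -> rho'E L'le lam'E.
have /andP[e0 e1] := e01.
have a0 i : 0 <= a i by rewrite aE usage_ge0.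
have M0 : 0 < M.
  by have [i] := usage_gt0 l; rewrite -aE => /lt_le_trans; apply.
have w0 i : 0 < w i by apply: lt_le_trans (iw i); exact: expR_gt0.
set W := \sum_i w i in iW rho'E; set Z := \sum_i w i * a i in rho'E.
have W0 : 0 < W.
  rewrite /W (bigD1 i0) //= ltr_pwDl //.
  by apply: sumr_ge0 => i _; exact: ltW.
have g01 i : 0 <= a i / M <= 1.
  by rewrite divr_ge0 ?(ltW M0) //= ler_pdivrMr // mul1r.
have Z0 : 0 <= Z by apply: sumr_ge0 => i _; rewrite mulr_ge0 // ltW.
have rho'ge : rho <= rho' by rewrite rho'E le_max lexx.
have rho'Z : Z / W <= rho' by rewrite rho'E le_max lexx orbT.
have rho'0 : 0 <= rho' by exact: le_trans rho'ge.
have v0 : 0 <= v by rewrite vE; apply: sumr_ge0.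
have Mi0 : 0 < M^-1 by rewrite invr_gt0.
(* Since [rho'] dominates both the old [rho] and the current ratio, the exponent in the bound on the
   total weight absorbs this step's growth. *)
have vrho : v * rho + M^-1 * (Z / W) <= (v + M^-1) * rho'.
  by rewrite mulrDl lerD // ler_wpM2l // ltW.
(* The total weight grows by exactly this factor, to which [1 + y <= expR y] is applied next. *)
have W'E : \sum_i w' i = W * (1 + e * (M^-1 * (Z / W))).
  have -> : W * (1 + e * (M^-1 * (Z / W))) = W + e * M^-1 * Z.
    by field; rewrite !gt_eqF.
  rewrite /Z mulr_sumr -big_split /=; apply: eq_bigr => i _.
  by rewrite w'E; field; rewrite gt_eqF.
have W'le : \sum_i w' i <= m%:R * expR (e * ((v + M^-1) * rho')).
  rewrite W'E; apply: (@le_trans _ _ (m%:R * expR (e * (v * rho)) *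
                          expR (e * (M^-1 * (Z / W))))).
    apply: ler_pM => //; first exact: ltW.
      by rewrite addr_ge0 // mulr_ge0 ?(ltW e0) // mulr_ge0 ?(ltW Mi0) // divr_ge0 // ltW.
    exact: expR_ge1Dx.
  by rewrite -mulrA -expRD ler_wpM2l // ler_expR -mulrDr ler_wpM2l // ltW.
have w'ge i : expR (e * (1 - e) * L' i) <= w' i.
  rewrite L'E w'E mulrDr expRD; apply: ler_pM; rewrite ?expR_ge0 //.
  exact: le_expR1D.
have m0 : (0 : R) < m%:R by rewrite ltr0n; exact: leq_ltn_trans (ltn_ord i0).
split=> //.
(* A single weight is at most the total, so logarithms bound every new load. If [lam'] is the old
   [lam], its old bound is still valid because [v * rho] has not decreased. *)
- have L'b i : e * (1 - e) * L' i <= ln m%:R + e * ((v + M^-1) * rho').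
    rewrite -ler_expR expRD lnK ?posrE //; apply: le_trans (w'ge i) _.
    apply: le_trans W'le; rewrite (bigD1 i) //= lerDl.
    apply: sumr_ge0 => i' _; apply: le_trans (w'ge i'); exact: expR_ge0.
  case: lam'E => [->|[i ->]] //; apply: le_trans ilam _.
  rewrite lerD2l ler_wpM2l ?(ltW e0) //; apply: le_trans vrho; rewrite lerDl.
  by rewrite mulr_ge0 ?(ltW Mi0) // divr_ge0 // ltW.
(* The row attaining the maximum [M] gains exactly 1, and no row loses load. *)
- have -> : \sum_i L' i = \sum_i L i + \sum_i a i / M.
    by rewrite -big_split; apply: eq_bigr => i _; rewrite L'E.
  rewrite -natr1 lerD // (bigD1 i0) //= ai0 divff ?gt_eqF // lerDl.
  by apply: sumr_ge0 => i _; case/andP: (g01 i).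
- move=> beta beta0 ub.
  (* After exchanging the sums, the price of [z] is its usage weighted by [w]. *)
  have dotu z : dot (\col_j \sum_i (A i j)%:R * (w i / (b i 0)%:R)) z =
                \sum_i w i * usage z i.
    rewrite dotE; under eq_bigr do rewrite mxE mulr_suml.
    rewrite exchange_big; apply: eq_bigr => i _ /=.
    rewrite usageE mulr_sumr; apply: eq_bigr => j _.
    by rewrite -!mulrA mulrCA [_^-1 * _]mulrC.
  (* Weak duality: no generator is cheaper than [X l], so [Z] times the sum of [beta] is at most the
     price of the combination, which is at most [W] since its usages are at most 1. *)
  have dual : Z / W * \sum_l beta l <= 1.
    rewrite mulrAC ler_pdivrMr // mul1r.
    have -> : Z = dot (\col_j \sum_i (A i j)%:R * (w i / (b i 0)%:R)) (X l).
      by rewrite dotu; apply: eq_bigr => i _; rewrite aE.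
    apply: (@le_trans _ _ (dot (\col_j \sum_i (A i j)%:R * (w i / (b i 0)%:R))
                        (\sum_l beta l *: X l))).
      by rewrite dot_sumr mulr_sumr; apply: ler_sum => l' _; rewrite mulrC ler_wpM2l.
    rewrite dotu; apply: ler_sum => i _; rewrite -[leRHS]mulr1.
    by rewrite ler_wpM2l // ltW.
  by rewrite rho'E maxEle; case: ifP => _; [exact: dual | exact: idual].
- exists (fun l' => alpha l' + (if l' == l then M^-1 else 0)).
    by move=> l'; rewrite addr_ge0 //; case: eqP => // _; exact: ltW.
  split.
    rewrite xE; under [RHS]eq_bigr do rewrite scalerDl.
    rewrite big_split /=; congr (_ + _); rewrite (bigD1 l) //= eqxx big1 ?addr0 //.
    by move=> l' /negbTE ->; rewrite scale0r.
  rewrite vE big_split /=; congr (_ + _); rewrite (bigD1 l) //= eqxx big1 ?addr0 //.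
  by move=> l' /negbTE ->.
- by move=> i; rewrite usageD usageZ iu -aE L'E mulrC.
Qed.

Lemma mwu_bound T w L x v rho lam : (0 < m)%N ->
  mwu_inv T w L x v rho lam ->
  ~~ ((1 - eps) * lam < v * rho) ->
  T%:R <= 4%:R * (m%:R * ln m%:R) / eps ^+ 2.
Proof.
move=> m0 [_ _ iL ilam iT _ _ _ _]; rewrite -leNgt => guard.
have /andP[eps0 eps1] := eps01.
have TL : T%:R <= m%:R * lam.
  apply: le_trans iT _; apply: (@le_trans _ _ (\sum_(i < m) lam)).
    by apply: ler_sum => i _; exact: iL.
  by rewrite sumr_const card_ord mulr_natl.
(* For [e = eps / 2] one has [e * (1 - e) - e * (1 - eps) = eps ^+ 2 / 4], the source of the factor
   4. *)
have lamB : eps ^+ 2 * lam <= 4%:R * ln m%:R.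
  have : e * (v * rho) <= e * ((1 - eps) * lam).
    by rewrite ler_wpM2l // /e; lra.
  by move: ilam; rewrite /e; lra.
rewrite ler_pdivlMr ?exprn_gt0 //.
have mp : (0 : R) <= m%:R by [].
have e2 : 0 <= eps ^+ 2 by exact: sqr_ge0.
apply: (@le_trans _ _ (m%:R * (eps ^+ 2 * lam))).
  by rewrite [leRHS]mulrCA [leLHS]mulrC ler_wpM2l.
by rewrite [leRHS]mulrCA ler_wpM2l.
Qed.

(** Division by [lam] brings all loads down to at most 1. If [B] is the coefficient sum of an
    optimum, then [rho * B <= 1], whence [(1 - eps) * lam * B <= v * rho * B <= v]; objective values
    are [chat] times coefficient sums. *)
Lemma mwu_approx (c : 'cV[int]_n) (chat : R) T w L x v rho lam :
  (0 < m)%N -> 0 < chat -> (forall l, dot (intmx R c) (X l) = chat) ->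
  mwu_inv T w L x v rho lam ->
  (1 - eps) * lam < v * rho ->
  approx_solution A b c X eps (lam^-1 *: x).
Proof.
move=> m0 chat0 cX [_ _ iL _ _ rho0 idual [alpha alpha0 [xE vE]] iu] guard.
have /andP[eps0 eps1] := eps01.
have L0 i : 0 <= L i.
  rewrite -iu xE usage_sum; apply: sumr_ge0 => l _.
  by rewrite mulr_ge0 ?usage_ge0.
have lam0 : 0 <= lam by apply: le_trans (iL (Ordinal m0)).
(* The test is strict and [(1 - eps) * lam] is non-negative, so [v] cannot vanish. Hence some
   coefficient is positive, its generator loads a row, and [lam] is positive as well. *)
have v0 : 0 < v.
  rewrite lt_def vE sumr_ge0 // andbT; apply: contraTneq guard => v0.
  by rewrite vE v0 mul0r -leNgt mulr_ge0 // subr_ge0 ltW.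
have {lam0} lam0 : 0 < lam.
  have [l al0] : exists l, 0 < alpha l.
    apply/existsP; apply: contraTT v0 => /existsPn H.
    by rewrite vE -leNgt sumr_le0 // => l _; rewrite leNgt H.
  have [i ui] := usage_gt0 l.
  apply: lt_le_trans (iL i); rewrite -iu xE usage_sum (bigD1 l) //= ltr_pwDl //.
    by rewrite mulr_gt0.
  by apply: sumr_ge0 => l' _; rewrite mulr_ge0 ?usage_ge0.
have cdot (beta : 'I_k -> R) :
    dot (intmx R c) (\sum_l beta l *: X l) = chat * \sum_l beta l.
  by rewrite dot_sumr mulr_sumr; apply: eq_bigr => l _; rewrite cX mulrC.
have x'E : lam^-1 *: x = \sum_l (lam^-1 * alpha l) *: X l.
  by rewrite xE scaler_sumr; apply: eq_bigr => l _; rewrite scalerA.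
split.
  split=> [i|].
    by rewrite usage_le1 usageZ iu mulrC ler_pdivrMr ?mul1r.
  by exists (fun l => lam^-1 * alpha l) => // l; rewrite mulr_ge0 // invr_ge0 ltW.
have [xopt opt] := optimal_exists c; exists xopt => //.
have [[ub [beta beta0 xoptE]] _] := opt.
rewrite x'E xoptE !cdot -mulr_sumr -vE mulrCA ler_wpM2l ?(ltW chat0) //.
rewrite [leRHS]mulrC ler_pdivlMr // mulrAC.
have {ub}dual : rho * \sum_l beta l <= 1.
  by apply: idual => // i; rewrite -xoptE -usage_le1.
have B0 : 0 <= \sum_l beta l by apply: sumr_ge0.
apply: (@le_trans _ _ (v * rho * \sum_l beta l)).
  by rewrite ler_wpM2r // ltW.
by rewrite -mulrA -[leRHS]mulr1 ler_wpM2l // ltW.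
Qed.

End Packing.

(** * The program *)

Definition reg_m := 0%N.
Definition reg_n := 1%N.
Definition reg_nnz := 2%N.
Definition reg_i := 3%N.
Definition reg_j := 4%N.
Definition reg_pos := 5%N.

Definition arr_row := 0%N.
Definition arr_col := 1%N.

Definition reg_eps := 0%N.
Definition reg_v := 1%N.
Definition reg_rho := 2%N.
Definition reg_lam := 3%N.
Definition reg_max := 4%N.
Definition reg_W := 5%N.
Definition reg_Z := 6%N.

Definition arr_val := 6%N.
Definition arr_w := 7%N.
Definition arr_use := 8%N.
Definition arr_load := 9%N.

Definition ISucc (x : nat) : cmd := ISet x (IAdd (IReg x) (INat 1)).

(* The nonzero entries of A are stored as triples (row, column, value). *)
Definition sparsify_entry : cmd :=
  Seq (If (RLt (RNat 0) (RGet arr_A (IReg reg_pos)))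
         (Seq (IPut arr_row (IReg reg_nnz) (IReg reg_i))
         (Seq (IPut arr_col (IReg reg_nnz) (IReg reg_j))
         (Seq (RPut arr_val (IReg reg_nnz) (RGet arr_A (IReg reg_pos)))
              (ISucc reg_nnz))))
         Skip)
      (ISucc reg_pos).

(** Index expressions have no multiplication, so [reg_pos] runs along the row-major array instead of
    being computed from row and column. *)
Definition sparsify : cmd :=
  Seq (Seq (ISet reg_nnz (INat 0)) (ISet reg_pos (INat 0)))
      (For reg_i reg_m (For reg_j reg_n sparsify_entry)).

(** A sparse matrix-vector product in either direction: targets taken from the column indices give a
    product with the transpose of [A], targets from the row indices a product with [A]. *)
Definition scatter (dst idx len : nat) (e : rexp) : cmd :=
  Seq (For reg_i len (RPut dst (IReg reg_i) (RNat 0)))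
      (For reg_i reg_nnz
         (RPut dst (IGet idx (IReg reg_i))
            (RAdd (RGet dst (IGet idx (IReg reg_i)))
                  (RMul (RGet arr_val (IReg reg_i)) e)))).

Definition make_query : cmd :=
  scatter arr_query arr_col reg_n
    (RDiv (RGet arr_w (IGet arr_row (IReg reg_i)))
          (RGet arr_b (IGet arr_row (IReg reg_i)))).

Definition compute_usage : cmd :=
  scatter arr_use arr_row reg_m
    (RDiv (RGet arr_answer (IGet arr_col (IReg reg_i)))
          (RGet arr_b (IGet arr_row (IReg reg_i)))).

Definition statistics : cmd :=
  Seq (Seq (RSet reg_max (RNat 0)) (Seq (RSet reg_W (RNat 0)) (RSet reg_Z (RNat 0))))
      (For reg_i reg_m
        (Seq (If (RLt (RReg reg_max) (RGet arr_use (IReg reg_i)))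
                 (RSet reg_max (RGet arr_use (IReg reg_i))) Skip)
        (Seq (RSet reg_W (RAdd (RReg reg_W) (RGet arr_w (IReg reg_i))))
             (RSet reg_Z (RAdd (RReg reg_Z)
                (RMul (RGet arr_w (IReg reg_i)) (RGet arr_use (IReg reg_i)))))))).

Definition update_values : cmd :=
  Seq (If (RLt (RReg reg_rho) (RDiv (RReg reg_Z) (RReg reg_W)))
          (RSet reg_rho (RDiv (RReg reg_Z) (RReg reg_W))) Skip)
      (RSet reg_v (RAdd (RReg reg_v) (RDiv (RNat 1) (RReg reg_max)))).

Definition update_solution : cmd :=
  For reg_i reg_n
    (RPut arr_output (IReg reg_i)
       (RAdd (RGet arr_output (IReg reg_i))
             (RDiv (RGet arr_answer (IReg reg_i)) (RReg reg_max)))).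

Definition update_weights : cmd :=
  For reg_i reg_m
    (Seq (RPut arr_w (IReg reg_i)
            (RMul (RGet arr_w (IReg reg_i))
               (RAdd (RNat 1) (RMul (RDiv (RReg reg_eps) (RNat 2))
                  (RDiv (RGet arr_use (IReg reg_i)) (RReg reg_max))))))
    (Seq (RPut arr_load (IReg reg_i)
            (RAdd (RGet arr_load (IReg reg_i))
                  (RDiv (RGet arr_use (IReg reg_i)) (RReg reg_max))))
         (If (RLt (RReg reg_lam) (RGet arr_load (IReg reg_i)))
             (RSet reg_lam (RGet arr_load (IReg reg_i))) Skip))).

Definition iteration : cmd :=
  Seq make_query
  (Seq CallOracle
  (Seq compute_usage
  (Seq statistics
  (Seq update_values
  (Seq update_solution update_weights))))).

(** Right after [initialize] both sides are 0, so the strict inequality fails and the loop is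
    entered at least once. *)
Definition gap_open : bexp :=
  BNot (RLt (RMul (RSub (RNat 1) (RReg reg_eps)) (RReg reg_lam))
            (RMul (RReg reg_v) (RReg reg_rho))).

Definition initialize : cmd :=
  Seq (For reg_i reg_n (RPut arr_output (IReg reg_i) (RNat 0)))
  (Seq (For reg_i reg_m (Seq (RPut arr_w (IReg reg_i) (RNat 1))
                             (RPut arr_load (IReg reg_i) (RNat 0))))
       (Seq (RSet reg_v (RNat 0))
       (Seq (RSet reg_rho (RNat 0)) (RSet reg_lam (RNat 0))))).

Definition normalize : cmd :=
  For reg_i reg_n
    (RPut arr_output (IReg reg_i)
       (RDiv (RGet arr_output (IReg reg_i)) (RReg reg_lam))).

Definition packing_program : cmd :=
  Seq (Seq sparsify initialize) (Seq (While gap_open iteration) normalize).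

(** * Correctness and running time *)

Section Verification.
Variables (R : realType) (m n : nat) (orc : 'cV[R]_n -> 'cV[R]_n).
Implicit Types s : state R.

(** The hypothesis on [e] makes its value depend on the counter only, whatever the loops do to
    [dst]; it is thus a fixed sequence [g]. *)
Lemma runs_scatter dst idx len e l (g : nat -> R) s0 t :
  len != reg_i -> dst != arr_val -> ireg s0 len = l ->
  (20 * (l + ireg s0 reg_nnz + 1) + ireg s0 reg_nnz * rcost e <= t)%N ->
  (forall s k, agree_off [:: LIreg reg_i; LRarr dst] s0 s -> ireg s reg_i = k ->
     reval s e = g k) ->
  runs orc (scatter dst idx len e) s0 t 0 (fun s => forall j, (j < l)%N ->
    rarr s dst j = \sum_(k < ireg s0 reg_nnz)
      if iarr s0 idx k == j then rarr s0 arr_val k * g k else 0).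
Proof.
move=> leni dstv lE le He; rewrite /scatter.
set N := ireg s0 reg_nnz in le *.
apply: (runs_then (t1 := (5 + l * 10)%N) (Q1 := fun s => forall j, (j < l)%N ->
    rarr s dst j = 0)); last 2 first.
- by lia.
- move=> s1 F1 H1; have [Fi Fa Fr Fq] := F1.
  apply: (runs_for_loop_free orc (b := N) (I := fun K s => forall j, (j < l)%N ->
    rarr s dst j = \sum_(k < K)
      if iarr s0 idx k == j then rarr s0 arr_val k * g k else 0)) => //.
  + by rewrite Fi.
  + by rewrite /=; lia.
  + by move=> j jl; rewrite big_ord0 /= H1.
  + move=> k s kN sk F IH j jl /=; rewrite big_ord_recr /= -IH //.
    have F' : agree_off [:: LIreg reg_i; LRarr dst] s0 s.
      by apply: agree_off_trans (agree_off_sub _ F1) F => z; rewrite !inE; do ?case: eqP.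
    have [_ Fa' _ Fq'] := F'.
    rewrite /upd eqxx /= sk (He s k) // Fa' // (Fq' arr_val) //; last first.
      by rewrite !inE /=; apply: contra dstv => /eqP[->].
    by rewrite eq_sym; case: eqP => [->|]; rewrite ?addr0.
- apply: (runs_for_loop_free orc (I := fun K s => forall j, (j < K)%N ->
    rarr s dst j = 0)) => //.
  + by rewrite eq_sym.
  + move=> k s kl sk F IH j; rewrite ltnS leq_eqVlt /= /upd eqxx sk.
    by case: eqP => //= _ /IH.
Qed.

(** * The sparse copy of the matrix and the single phases of the program *)

Variable A : 'M[nat]_(m, n).

(* Quantifying over f makes both A^T y (f r c = y r, restricted to one column)
   and A z (f r c = z c, restricted to one row) instances of one identity. *)
Definition sparse_copy s : Prop :=
  (ireg s reg_nnz <= nnz A)%N /\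
  forall f : nat -> nat -> R,
    \sum_(k < ireg s reg_nnz)
       rarr s arr_val k * f (iarr s arr_row k) (iarr s arr_col k) =
    \sum_(i < m) \sum_(j < n) (A i j)%:R * f i j.

Lemma nnzE : nnz A = (\sum_(i < m) \sum_(j < n) (A i j != 0))%N.
Proof.
rewrite /nnz -sum1_card pair_big /= big_mkcond /=.
by apply: eq_bigr => ij _; rewrite inE; case: eqP.
Qed.

Lemma runs_sparsify s0 t :
  ireg s0 reg_m = m -> ireg s0 reg_n = n ->
  (forall (i : 'I_m) (j : 'I_n), rarr s0 arr_A (i * n + j)%N = (A i j)%:R) ->
  (100 * (m * n + m + 1) <= t)%N ->
  runs orc sparsify s0 t 0 sparse_copy.
Proof.
move=> sm sn sA le; pose a := rarr s0 arr_A.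
(* The scan has treated all entries before (i, j) in row-major order; [a] freezes the stored
   matrix. *)
pose part i j s := [/\ ireg s reg_pos = (i * n + j)%N,
  ireg s reg_nnz = (\sum_(i' < i) \sum_(j' < n) (0 < a (i' * n + j')%N)%R +
                    \sum_(j' < j) (0 < a (i * n + j')%N)%R)%N
  & forall f : nat -> nat -> R,
    \sum_(k < ireg s reg_nnz)
       rarr s arr_val k * f (iarr s arr_row k) (iarr s arr_col k) =
    \sum_(i' < i) \sum_(j' < n) a (i' * n + j')%N * f i' j' +
    \sum_(j' < j) a (i * n + j')%N * f i j'].
rewrite /sparsify.
apply: (runs_then (t1 := 4%N) (Q1 := fun s => part 0%N 0%N s)).
- apply: runs_loop_free => //; rewrite /part /= /upd /= !big_ord0.
  by split=> // f; rewrite !big_ord0 addr0.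
- by lia.
move=> s1 F1 part0; have [Fi Fa Fr Fq] := F1.
have sm1 : ireg s1 reg_m = m by rewrite Fi.
pose c := (5 + n * 50)%N.
apply: runs_weaken (runs_for (c := c) (I := fun i s => part i 0%N s) _ _ _ _ _) _ _ => //.
- move=> i s; rewrite sm1 => im si F2 parti.
  have [Fi2 Fa2 Fr2 Fq2] := F2.
  have sAa : rarr s arr_A = a by rewrite Fq2 // Fq.
  have sn2 : ireg s reg_n = n by rewrite Fi2 // Fi.
  apply: runs_weaken (runs_for_loop_free orc (b := n) (t := c)
     (I := fun j s => part i j s) _ _ _ _ _ _ _ _) _ _ => //.
  + by rewrite /c /=; lia.
  + move=> j s2 jn s2j F3 [p1 p2 p3].
    have [Fi3 Fa3 Fr3 Fq3] := F3.
    have s2A : rarr s2 arr_A = a by rewrite Fq3.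
    have s2i : ireg s2 reg_i = i by rewrite Fi3.
    have aE : a (i * n + j)%N = (A (Ordinal im) (Ordinal jn))%:R by rewrite -sA.
    rewrite /part /=; split.
    * by rewrite p1 /= s2A; case: ifP; rewrite /= /upd /= p1 addn1 addnS.
    * rewrite big_ord_recr /= addnA -p2 s2A p1.
      by case: ifP; rewrite /= /upd /= ?addn0.
    * move=> f; rewrite big_ord_recr /= addrA -p3 s2A p1.
      case: ifP => aij; rewrite /= /upd /= ?addn1 ?s2A ?p1.
        rewrite big_ord_recr /= !eqxx s2i s2j; congr (_ + _).
        by apply: eq_bigr => k _; rewrite ltn_eqF.
      (* A skipped entry is not positive, hence 0, and adds nothing to the sum for any [f]. *)
      have -> : a (i * n + j)%N = 0.
        by apply/eqP; move: aij; rewrite aE ltr0n lt0n pnatr_eq0 => /negbFE.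
      by rewrite mul0r addr0.
  (* The end (i, n) of a row is the beginning (i + 1, 0) of the next one. *)
  + move=> s2 _ [p1 p2 p3]; split.
    * by rewrite /= /upd /= p1 mulSn addn0 addnC.
    * by rewrite /= /upd /= p2 big_ord_recr /= big_ord0 addn0.
    * by move=> f; rewrite /= /upd /= p3 big_ord_recr /= big_ord0 addr0.
- by rewrite sm1 /c; nia.
- rewrite sm1 => s2 _ [p1 p2 p3]; split.
    rewrite p2 nnzE big_ord0 addn0; apply: leq_sum => i _; apply: leq_sum => j _.
    by rewrite /a sA ltr0n lt0n.
  move=> f; rewrite p3 big_ord0 addr0; apply: eq_bigr => i _; apply: eq_bigr => j _.
  by rewrite /a sA.
Qed.

Lemma runs_initialize s0 t :
  ireg s0 reg_m = m -> ireg s0 reg_n = n -> (100 * (m + n + 1) <= t)%N ->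
  runs orc initialize s0 t 0 (fun s =>
    [/\ forall i, (i < m)%N -> rarr s arr_w i = 1 /\ rarr s arr_load i = 0,
        forall j, (j < n)%N -> rarr s arr_output j = 0
      & [/\ rreg s reg_v = 0, rreg s reg_rho = 0 & rreg s reg_lam = 0]]).
Proof.
move=> sm sn le; rewrite /initialize.
apply: (runs_then (t1 := (5 + n * 10)%N) (Q1 := fun s => forall j, (j < n)%N ->
    rarr s arr_output j = 0)).
- apply: (runs_for_loop_free orc (I := fun K s => forall j, (j < K)%N ->
    rarr s arr_output j = 0)) => //.
  move=> k s kl sk F IH j; rewrite ltnS leq_eqVlt /= /upd /= sk.
  by case: eqP => //= _ /IH.
- by lia.
move=> s1 [Fi _ _ _] H1.
apply: (runs_then (t1 := (5 + m * 20)%N) (Q1 := fun s => forall i, (i < m)%N ->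
    rarr s arr_w i = 1 /\ rarr s arr_load i = 0)).
- apply: (runs_for_loop_free orc (I := fun K s => forall i, (i < K)%N ->
    rarr s arr_w i = 1 /\ rarr s arr_load i = 0)) => //.
  + by rewrite Fi.
  + by rewrite /=; lia.
  + move=> k s kl sk F IH j; rewrite ltnS leq_eqVlt /= /upd /= sk.
    by case: eqP => //= _ /IH.
- by lia.
move=> s2 [_ _ _ Fq] H2; apply: runs_weaken (runs_loop_free orc _ _) _ _.
- by [].
- exact: erefl.
- by rewrite /=; lia.
move=> s3 _ <-; split=> //= j jn.
by rewrite Fq // H1.
Qed.

(** The register for the maximum starts at 0, which need not be the usage of a row; that alternative
    is ruled out later, because a generator loads some row. *)
Lemma runs_statistics s0 t :
  ireg s0 reg_m = m -> (100 * (m + 1) <= t)%N ->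
  runs orc statistics s0 t 0 (fun s =>
    [/\ forall i, (i < m)%N -> rarr s0 arr_use i <= rreg s reg_max,
        rreg s reg_max = 0 \/
        exists2 i, (i < m)%N & rarr s0 arr_use i = rreg s reg_max,
        rreg s reg_W = \sum_(i < m) rarr s0 arr_w i
      & rreg s reg_Z = \sum_(i < m) rarr s0 arr_w i * rarr s0 arr_use i]).
Proof.
move=> sm le; pose P k s :=
  [/\ forall i, (i < k)%N -> rarr s0 arr_use i <= rreg s reg_max,
      rreg s reg_max = 0 \/
      exists2 i, (i < k)%N & rarr s0 arr_use i = rreg s reg_max,
      rreg s reg_W = \sum_(i < k) rarr s0 arr_w i
    & rreg s reg_Z = \sum_(i < k) rarr s0 arr_w i * rarr s0 arr_use i].
apply: (runs_then (t1 := 6%N) (Q1 := P 0%N)).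
- apply: runs_loop_free => //; rewrite /P /= /upd /= !big_ord0.
  by split=> //; left.
- by lia.
move=> s1 [Fi _ _ Fq] P0; apply: (runs_for_loop_free orc (I := P)) => //.
- by rewrite Fi.
- by rewrite /=; lia.
move=> k s kb sk [Fi' _ _ Fq'] [p1 p2 p3 p4].
have su : rarr s arr_use = rarr s0 arr_use by rewrite Fq' ?Fq.
have sw : rarr s arr_w = rarr s0 arr_w by rewrite Fq' ?Fq.
rewrite /P /= sk su; case: ifP => cmp; rewrite /= /upd /= sk ?su ?sw !big_ord_recr /= p3 p4.
  split=> //; last by right; exists k.
  by move=> i; rewrite ltnS leq_eqVlt => /predU1P[->//|/p1/le_trans]; apply; exact: ltW.
split=> //.
  move=> i; rewrite ltnS leq_eqVlt => /predU1P[->|/p1//].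
  by rewrite leNgt cmp.
case: p2 => [|[i ik pi]]; [by left | right; exists i => //].
exact: ltnW.
Qed.

Lemma runs_update_solution s0 t :
  ireg s0 reg_n = n -> (100 * (n + 1) <= t)%N ->
  runs orc update_solution s0 t 0 (fun s => forall j, (j < n)%N ->
    rarr s arr_output j =
    rarr s0 arr_output j + rarr s0 arr_answer j / rreg s0 reg_max).
Proof.
(* The update is in place, so the invariant also records that cells from [k] on keep their old
   values. *)
move=> sn le; pose P k s := forall j, rarr s arr_output j =
  if (j < k)%N then rarr s0 arr_output j + rarr s0 arr_answer j / rreg s0 reg_max
  else rarr s0 arr_output j.
apply: runs_weaken (runs_for_loop_free orc (b := n) (t := t) (I := P) _ _ _ _ _ _ _ _) _ _ => //.
- by rewrite /=; lia.
- move=> k s kn sk [_ _ Fr Fq] IH j; rewrite /= /upd /= sk IH ltnn Fq // Fr //.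
  by rewrite ltnS leq_eqVlt; case: eqP => [->|_] //=; rewrite IH.
by move=> s _ H j jn; rewrite H jn.
Qed.

Lemma runs_normalize s0 t :
  ireg s0 reg_n = n -> (100 * (n + 1) <= t)%N ->
  runs orc normalize s0 t 0 (fun s => forall j, (j < n)%N ->
    rarr s arr_output j = rarr s0 arr_output j / rreg s0 reg_lam).
Proof.
move=> sn le; pose P k s := forall j, rarr s arr_output j =
  if (j < k)%N then rarr s0 arr_output j / rreg s0 reg_lam
  else rarr s0 arr_output j.
apply: runs_weaken (runs_for_loop_free orc (b := n) (t := t) (I := P) _ _ _ _ _ _ _ _) _ _ => //.
- by rewrite /=; lia.
- move=> k s kn sk [_ _ Fr Fq] IH j; rewrite /= /upd /= sk IH ltnn Fr //.
  by rewrite ltnS leq_eqVlt; case: eqP => [->|_] //=; rewrite IH.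
by move=> s _ H j jn; rewrite H jn.
Qed.

Lemma runs_update_weights s0 t :
  ireg s0 reg_m = m -> (100 * (m + 1) <= t)%N ->
  let g i := rarr s0 arr_use i / rreg s0 reg_max in
  runs orc update_weights s0 t 0 (fun s =>
    [/\ forall i, (i < m)%N -> rarr s arr_w i =
          rarr s0 arr_w i * (1 + rreg s0 reg_eps / 2%:R * g i),
        forall i, (i < m)%N -> rarr s arr_load i = rarr s0 arr_load i + g i,
        forall i, (i < m)%N -> rarr s arr_load i <= rreg s reg_lam
      & rreg s reg_lam = rreg s0 reg_lam \/
        exists2 i, (i < m)%N & rreg s reg_lam = rarr s arr_load i]).
Proof.
(* The maximum is tracked in terms of the initial memory, since the load array itself changes during
   the loop. *)
move=> sm le g; pose P k s :=
  [/\ forall i, rarr s arr_w i =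
        if (i < k)%N then rarr s0 arr_w i * (1 + rreg s0 reg_eps / 2%:R * g i)
        else rarr s0 arr_w i,
      forall i, rarr s arr_load i =
        if (i < k)%N then rarr s0 arr_load i + g i else rarr s0 arr_load i,
      forall i, (i < k)%N -> rarr s0 arr_load i + g i <= rreg s reg_lam
    & rreg s reg_lam = rreg s0 reg_lam \/
      exists2 i, (i < k)%N & rreg s reg_lam = rarr s0 arr_load i + g i].
apply: runs_weaken (runs_for_loop_free orc (b := m) (t := t) (I := P) _ _ _ _ _ _ _ _) _ _ => //.
- by rewrite /=; lia.
- by split=> //; left.
- move=> k s km sk [_ _ Fr Fq] [p1 p2 p3 p4].
  have su : rarr s arr_use = rarr s0 arr_use by rewrite Fq.
  have sM : rreg s reg_max = rreg s0 reg_max by rewrite Fr.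
  have se : rreg s reg_eps = rreg s0 reg_eps by rewrite Fr.
  rewrite /P /= /upd /= sk eqxx su sM se !p1 !p2 ltnn -/(g k).
  set lk := rarr s0 arr_load k + g k.
  have wk i : (if i == k then rarr s0 arr_w k * (1 + rreg s0 reg_eps / 2%:R * g k)
               else rarr s arr_w i) =
      if (i < k.+1)%N then rarr s0 arr_w i * (1 + rreg s0 reg_eps / 2%:R * g i)
      else rarr s0 arr_w i.
    by rewrite ltnS leq_eqVlt p1; case: eqP => [->|_].
  have Lk i : (if i == k then lk else rarr s arr_load i) =
      if (i < k.+1)%N then rarr s0 arr_load i + g i else rarr s0 arr_load i.
    by rewrite ltnS leq_eqVlt p2; case: eqP => [->|_].
  case: ifP => cmp; split=> //=; rewrite /upd /=.
  + move=> i; rewrite ltnS leq_eqVlt => /predU1P[->//|/p3/le_trans]; apply.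
    exact: ltW.
  + by right; exists k.
  + move=> i; rewrite ltnS leq_eqVlt => /predU1P[->|/p3//].
    by rewrite leNgt cmp.
  + case: p4 => [->|[i ik ->]]; [by left | right; exists i => //].
    exact: ltnW.
move=> s _ [p1 p2 p3 p4]; split=> //.
- by move=> i im; rewrite p1 im.
- by move=> i im; rewrite p2 im.
- by move=> i im; rewrite p2 im p3.
- by case: p4 => [|[i im ->]]; [left | right; exists i => //; rewrite p2 im].
Qed.

(** * One pass of the main loop *)

Variables (k : nat) (b : 'cV[nat]_m) (X : 'I_k -> 'cV[R]_n) (eps : R).
Hypothesis A_col : forall j, exists i, (0 < A i j)%N.
Hypothesis b_gt0 : forall i, (0 < b i ord0)%N.
Hypothesis X_ge0 : forall l, (forall j, 0 <= X l j 0) /\ X l <> 0.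
Hypothesis eps01 : 0 < eps < 1.
Hypothesis orcX : minimizing_oracle X orc.

Lemma runs_update_values s0 t : (100 <= t)%N ->
  runs orc update_values s0 t 0 (fun s =>
    rreg s reg_rho = Num.max (rreg s0 reg_rho) (rreg s0 reg_Z / rreg s0 reg_W) /\
    rreg s reg_v = rreg s0 reg_v + (rreg s0 reg_max)^-1).
Proof.
move=> le; apply: runs_weaken (runs_loop_free orc _ _) _ _.
- by [].
- exact: erefl.
- exact: leq_trans le.
by move=> s _ <- /=; case: ltP => _; rewrite /= /upd /= div1r.
Qed.

Definition loop_inv T s : Prop :=
  [/\ ireg s reg_m = m /\ ireg s reg_n = n,
      rreg s reg_eps = eps,
      forall i : 'I_m, rarr s arr_b i = (b i 0)%:R,
      sparse_copy s
    & mwu_inv A b X eps T (fun i => rarr s arr_w i) (fun i => rarr s arr_load i)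
        (read_vec n (rarr s arr_output))
        (rreg s reg_v) (rreg s reg_rho) (rreg s reg_lam)].

(** The phases produce exactly the data that [mwu_step] asks for, and frame facts carry everything
    else from one phase to the next. *)
Lemma runs_iteration T s0 t :
  (1000 * (m + n + nnz A + 1) <= t)%N -> loop_inv T s0 ->
  runs orc iteration s0 t 1 (loop_inv T.+1).
Proof.
move=> le [[sm sn] se sb [Nle sp] inv]; rewrite /iteration.
set N := ireg s0 reg_nnz in Nle sp.
pose row := iarr s0 arr_row; pose col := iarr s0 arr_col.
apply: (runs_then (t1 := (20 * (n + N + 1) + N * 10)%N)
  (runs_scatter (l := n) (t := (20 * (n + N + 1) + N * 10)%N)
    (g := fun k => rarr s0 arr_w (row k) / rarr s0 arr_b (row k)) _ _ _ _ _ _)) => //.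
- by rewrite /= -/N; lia.
- by move=> s k0 [_ Fa _ Fq] sk; rewrite /= sk Fa // !Fq.
- by lia.
move=> s1 [Fi1 Fa1 Fr1 Fq1] query1.
have dE : read_vec n (rarr s1 arr_query) =
    \col_j \sum_i (A i j)%:R * (rarr s0 arr_w i / (b i 0)%:R).
  apply/matrixP => j j0; rewrite !mxE query1 //.
  transitivity (\sum_(k0 < N) rarr s0 arr_val k0 *
      (if col k0 == j then rarr s0 arr_w (row k0) / rarr s0 arr_b (row k0) else 0)).
    by apply: eq_bigr => k0 _; case: ifP => _ //; rewrite mulr0.
  (* Testing the sparse copy against the indicator of column [j] isolates one entry of the product;
     the usages below are obtained with the indicator of a row. *)
  rewrite (sp (fun r c => if c == j then rarr s0 arr_w r / rarr s0 arr_b r else 0)).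
  apply: eq_bigr => i _; rewrite (bigD1 j) //= eqxx sb big1 ?addr0 // => j' jj'.
  by rewrite ifN ?mulr0.
apply: runs_oracle; set s2 := call_oracle orc s1.
have [l orcl lmin] := orcX (read_vec n (rarr s1 arr_query)).
(* An opaque name for the answer array keeps later simplification from unfolding the oracle call. *)
have [u uE] : exists u, rarr s2 arr_answer = u by eexists.
have ans (j : 'I_n) : u j = X l j 0.
  by rewrite -uE /= /upd /= /write_vec valK orcl.
rewrite dE in lmin.
have s2m : ireg s2 reg_m = m by rewrite /= Fi1.
have s2N : ireg s2 reg_nnz = N by rewrite /= Fi1.
have s2b : rarr s2 arr_b = rarr s0 arr_b by rewrite /= /upd /= Fq1.
have s2w : rarr s2 arr_w = rarr s0 arr_w by rewrite /= /upd /= Fq1.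
have s2v : rarr s2 arr_val = rarr s0 arr_val by rewrite /= /upd /= Fq1.
have s2r : iarr s2 arr_row = row by rewrite /= Fa1.
have s2c : iarr s2 arr_col = col by rewrite /= Fa1.
apply: (runs_then (t1 := (20 * (m + N + 1) + N * 10)%N)
  (runs_scatter (l := m) (t := (20 * (m + N + 1) + N * 10)%N)
    (g := fun k => rarr s2 arr_answer (col k) / rarr s2 arr_b (row k)) _ _ _ _ _ _)) => //.
- by rewrite s2N /=; lia.
- by move=> s k0 [_ Fa _ Fq] sk; rewrite /= sk !Fa // s2r s2c !Fq.
- by lia.
rewrite s2N s2r s2v s2b uE => s3 [Fi3 Fa3 Fr3 Fq3] use3.
have useE (i : 'I_m) : rarr s3 arr_use i = usage A b (X l) i.
  rewrite use3 //.
  transitivity (\sum_(k0 < N) rarr s0 arr_val k0 *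
      (if row k0 == i then u (col k0) / rarr s0 arr_b (row k0) else 0)).
    by apply: eq_bigr => k0 _; case: ifP => _ //; rewrite mulr0.
  rewrite (sp (fun r c => if r == i then u c / rarr s0 arr_b r else 0)).
  rewrite usageE (bigD1 i) //= [X in _ + X]big1 ?addr0 => [|i' ii']; last first.
    by rewrite big1 // => j _; rewrite ifN ?mulr0.
  by apply: eq_bigr => j _; rewrite eqxx ans sb mulrA.
have s3m : ireg s3 reg_m = m by rewrite Fi3.
have s3w : rarr s3 arr_w = rarr s0 arr_w by rewrite Fq3.
apply: (runs_then (t1 := (100 * (m + 1))%N) (runs_statistics s3m (leqnn _))).
  by lia.
rewrite s3w => s4 [Fi4 Fa4 Fr4 Fq4] [Mge Mex W4 Z4].
apply: (runs_then (t1 := 100) (runs_update_values _ (leqnn _))); first by lia.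
move=> s5 [Fi5 Fa5 Fr5 Fq5]; rewrite W4 Z4 Fr4 // Fr4 // Fr3 // Fr3 // /= Fr1 // Fr1 //.
move=> [rho5 v5].
have s5n : ireg s5 reg_n = n by rewrite Fi5 // Fi4 // Fi3 //= Fi1.
apply: (runs_then (t1 := (100 * (n + 1))%N) (runs_update_solution s5n (leqnn _))).
  by lia.
have s5M : rreg s5 reg_max = rreg s4 reg_max by rewrite Fr5.
have s5o : rarr s5 arr_output = rarr s0 arr_output.
  by rewrite Fq5 // Fq4 // Fq3 //= /upd /= Fq1.
have s5a : rarr s5 arr_answer = u.
  by rewrite Fq5 // Fq4 // Fq3.
rewrite s5M s5o s5a => s6 [Fi6 Fa6 Fr6 Fq6] out6.
have s6m : ireg s6 reg_m = m by rewrite Fi6 // Fi5 // Fi4 // Fi3 //= Fi1.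
apply: runs_weaken (runs_update_weights s6m (leqnn _)) _ _; first by lia.
have s6M : rreg s6 reg_max = rreg s4 reg_max by rewrite Fr6 // Fr5.
have s6e : rreg s6 reg_eps = eps.
  by rewrite Fr6 // Fr5 // Fr4 // Fr3 //= Fr1.
have s6lam : rreg s6 reg_lam = rreg s0 reg_lam.
  by rewrite Fr6 // Fr5 // Fr4 // Fr3 //= Fr1.
have s6u : rarr s6 arr_use = rarr s3 arr_use by rewrite Fq6 // Fq5 // Fq4.
have s6w : rarr s6 arr_w = rarr s0 arr_w.
  by rewrite Fq6 // Fq5 // Fq4 // Fq3 //= /upd /= Fq1.
have s6L : rarr s6 arr_load = rarr s0 arr_load.
  by rewrite Fq6 // Fq5 // Fq4 // Fq3 //= /upd /= Fq1.
rewrite s6M s6e s6lam s6u s6w s6L => s7 [Fi7 Fa7 Fr7 Fq7] [w7 L7 lam7 lamex].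
set M := rreg s4 reg_max in Mge Mex v5 out6 w7 L7 s5M s6M *.
have s7i x : x \in [:: reg_m; reg_n; reg_nnz] -> ireg s7 x = ireg s0 x.
  by rewrite !inE => /or3P[] /eqP ->;
    rewrite Fi7 // Fi6 // Fi5 // Fi4 // Fi3 //= Fi1.
have s7a x : iarr s7 x = iarr s0 x.
  by rewrite Fa7 // Fa6 // Fa5 // Fa4 // Fa3 //= Fa1.
split.
- by rewrite !s7i.
- by rewrite Fr7.
- move=> i; rewrite Fq7 // Fq6 // Fq5 // Fq4 // Fq3 // s2b; exact: sb.
- rewrite /sparse_copy s7i // !s7a; split=> //.
  by rewrite Fq7 // Fq6 // Fq5 // Fq4 // Fq3 // s2v.
have -> : read_vec n (rarr s7 arr_output) =
    read_vec n (rarr s0 arr_output) + M^-1 *: X l.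
  apply/matrixP => j j0; rewrite !mxE Fq7 // out6 // ans (ord1 j0).
  by rewrite mulrC.
apply: (mwu_step A_col b_gt0 X_ge0 eps01 inv lmin (a := fun i => rarr s3 arr_use i) (M := M)).
- exact: useE.
- by move=> i; exact: Mge.
(* [M = 0] would contradict the positive usage of some row, so [M] is attained. *)
- have [i ui] := usage_gt0 A_col b_gt0 X_ge0 l.
  case: Mex => [M0|[i' im' iM]]; last by exists (Ordinal im').
  by have := Mge i (ltn_ord i); rewrite useE M0 leNgt ui.
- by move=> i; rewrite w7.
- by move=> i; rewrite L7.
- by rewrite Fr7 // Fr6.
- by rewrite Fr7 // Fr6.
- by move=> i; exact: lam7.
- by case: lamex => [|[i im H]]; [left | right; exists (Ordinal im)].
Qed.

(** * Dimension bounds and the complete run *)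

Lemma nnz_ge_rows : (forall i, exists j, (0 < A i j)%N) -> (m <= nnz A)%N.
Proof.
move=> A_row; rewrite nnzE -[leqLHS]card_ord -sum1_card; apply: leq_sum => i _.
by have [j Aij] := A_row i; rewrite (bigD1 j) //= -lt0n Aij.
Qed.

Lemma nnz_ge_cols : (n <= nnz A)%N.
Proof.
rewrite nnzE exchange_big -[leqLHS]card_ord -sum1_card; apply: leq_sum => j _.
by have [i Aij] := A_col j; rewrite (bigD1 i) //= -lt0n Aij.
Qed.

(** The oracle's answer to the query 0 shows that there is a generator; being non-zero it has a
    coordinate, and the column of [A] at that coordinate has a row. *)
Lemma dim_gt0 : (0 < m)%N /\ (0 < n)%N.
Proof.
have [l _ _] := orcX 0; have [_ Xl] := X_ge0 l.
have n0 : (0 < n)%N.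
  case: posnP => // n0; case: Xl; apply/matrixP => j.
  have jn : (0 < n)%N := leq_ltn_trans (leq0n j) (ltn_ord j).
  by rewrite n0 in jn.
split=> //; have [i _] := A_col (Ordinal n0).
exact: leq_ltn_trans (ltn_ord i).
Qed.

Lemma runs_packing_program (c : 'cV[int]_n) (chat : R) s :
  (forall i, exists j, (0 < A i j)%N) ->
  0 < chat -> (forall l, dot (intmx R c) (X l) = chat) ->
  input_state A b c eps s ->
  exists2 T : nat, T%:R <= 4%:R * (m%:R * ln m%:R) / eps ^+ 2 + 1 &
    runs orc packing_program s (1000 * (m * n) + 5000 * (T * nnz A)) T
      (fun s' => approx_solution A b c X eps (output n s')).
Proof.
move=> A_row chat0 cX [[sm sn] se sA sb _].
have [m0 n0] := dim_gt0; have /andP[eps0 eps1] := eps01.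
have mN := nnz_ge_rows A_row; have nN := nnz_ge_cols.
set N := nnz A in mN nN *.
pose B : R := 4%:R * (m%:R * ln m%:R) / eps ^+ 2.
have B0 : 0 <= B.
  by rewrite divr_ge0 ?sqr_ge0 // !mulr_ge0 // ln_ge0 // ler1n.
(* The number of oracle calls is known only after the preprocessing, whereas the sequencing rule
   fixes it in advance. So the postcondition of the oracle-free part asserts that [T] and the
   remaining run exist. *)
pose pre s' := exists2 T, (T <= (Num.truncn B).+1)%N &
  runs orc (Seq (While gap_open iteration) normalize) s'
    (10 + T * (10 + 1000 * (m + n + N + 1)) + 100 * (n + 1)) T
    (fun s'' => approx_solution A b c X eps (output n s'')).
have [s2 [t2 [e2 l2 [T TB [s3 [t3 [e3 l3 app]]]]]]] :
    runs orc (Seq sparsify initialize) s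
      (100 * (m * n + m + 1) + 100 * (m + n + 1)) 0 pre.
  apply: (runs_then (runs_sparsify sm sn sA (leqnn _))); first exact: leq_addr.
  move=> s1 [Fi1 Fa1 Fr1 Fq1] sp1.
  have s1m : ireg s1 reg_m = m by rewrite Fi1.
  have s1n : ireg s1 reg_n = n by rewrite Fi1.
  apply: runs_weaken (runs_initialize s1m s1n (leqnn _)) _ _; first by lia.
  move=> s2 [Fi2 Fa2 Fr2 Fq2] [wL out [v0 rho0 lam0]].
  have inv0 : loop_inv 0 s2.
    split.
    - by rewrite !Fi2.
    - by rewrite Fr2 // Fr1.
    - by move=> i; rewrite Fq2 // Fq1.
    - by rewrite /sparse_copy Fi2 // !Fa2 // Fq2.
    rewrite v0 rho0 lam0.
    have -> : (fun i : 'I_m => rarr s2 arr_w i) = fun=> 1.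
      by apply: boolp.funext => i; have [] := wL i (ltn_ord i).
    have -> : (fun i : 'I_m => rarr s2 arr_load i) = fun=> 0.
      by apply: boolp.funext => i; have [] := wL i (ltn_ord i).
    have -> : read_vec n (rarr s2 arr_output) = 0.
      by apply/matrixP => j j0; rewrite !mxE out.
    exact: mwu_inv0.
  (* An open guard gives [T <= B] before the pass, so one more pass may follow; this is the extra 1
     in the bound on [T]. *)
  have step T s3 : loop_inv T s3 -> beval s3 gap_open ->
      (T < (Num.truncn B).+1)%N /\
      runs orc iteration s3 (1000 * (m + n + N + 1)) 1 (loop_inv T.+1).
    move=> inv3 gap; split; last exact: runs_iteration.
    have [_ e3 _ _ inv] := inv3.
    rewrite ltnS truncn_ge_nat //; apply: (mwu_bound eps01 m0 inv).
    by move: gap; rewrite /= e3.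
  have [T TB runT] := runs_while inv0 step.
  exists T => //; rewrite -[X in runs _ _ _ _ X _]addn0.
  apply: runs_seq; apply: runs_weaken runT (leqnn _) _.
  move=> s3 [Fi3 Fa3 Fr3 Fq3] [inv3 gap].
  have [[_ s3n] e3 _ _ inv] := inv3.
  apply: runs_weaken (runs_normalize s3n (leqnn _)) (leqnn _) _ => s4 _ out4.
  have -> : output n s4 = (rreg s3 reg_lam)^-1 *: read_vec n (rarr s3 arr_output).
    by apply/matrixP => j j0; rewrite !mxE out4 // mulrC.
  apply: (mwu_approx A_col b_gt0 X_ge0 eps01 m0 chat0 cX inv).
  by move: gap; rewrite /= negbK e3.
exists T.
  apply: (@le_trans _ _ (Num.truncn B).+1%:R); first by rewrite ler_nat.
  by rewrite -natr1 lerD2r truncn_le.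
exists s3, (t2 + t3)%N; split=> //; first exact: exec_Seq e2 e3.
apply: leq_trans (leq_add l2 l3) _.
have mn : (m <= m * n)%N by rewrite leq_pmulr.
have nm : (n <= m * n)%N by rewrite leq_pmull.
(* As [m], [n] and 1 are all at most [N], a pass costs O(N). *)
have TN : (T * (m + n + N + 1) <= 4 * (T * N))%N.
  by rewrite mulnCA leq_mul2l; lia.
have TN' : (T <= T * N)%N by rewrite leq_pmulr; lia.
lia.
Qed.

End Verification.

(** The constant [kappa] expresses that the oracle time is in Omega(n). It pays for the single scan
    of the dense matrix, as [m * n <= m * TA / kappa]. *)
Theorem theorem1 (R : realType) :
  exists P : cmd,
  forall kappa : R, 0 < kappa ->
  exists2 K : R, 0 < K &
  forall (m n k : nat) (A : 'M[nat]_(m, n)) (b : 'cV[nat]_m) (c : 'cV[int]_n)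
         (X : 'I_k -> 'cV[R]_n) (orc : 'cV[R]_n -> 'cV[R]_n) (TA eps : R),
    (forall i, exists j, (0 < A i j)%N) ->
    (forall j, exists i, (0 < A i j)%N) ->
    (forall i, (0 < b i ord0)%N) ->
    (forall l, (forall j, 0 <= X l j 0) /\ X l <> 0) ->
    (exists2 chat : R, 0 < chat & forall l, dot (intmx R c) (X l) = chat) ->
    minimizing_oracle X orc ->
    kappa * n%:R <= TA ->
    0 < eps < 1 ->
  forall s : state R, input_state A b c eps s ->
  exists (s' : state R) (t q : nat),
    [/\ exec orc P s s' t q,
        approx_solution A b c X eps (output n s')
      & running_time TA t q <=
          K * (1 / eps ^+ 2 * (m%:R * log2 R m) * ((nnz A)%:R + TA))].
Proof.
exists packing_program => kappa kappa0.
(* The first summand covers the scan; the second is 5000 steps per pass and non-zero entry, times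
   the 5 in [T <= 5 * H] below. *)
exists (1000%:R / kappa + 25000%:R); first by rewrite ltr_wpDl ?divr_ge0 // ltW.
move=> m n k A b c X orc TA eps A_row A_col b_gt0 X_ge0 [chat chat0 cX] orcX.
move=> TAn eps01 s input; have /andP[eps0 eps1] := eps01.
have [T TB [s' [t [ex tle app]]]] :=
  runs_packing_program A_col b_gt0 X_ge0 eps01 orcX A_row chat0 cX input.
have [m0 n0] := dim_gt0 A_col X_ge0 orcX.
exists s', t, T; split=> //.
set H : R := 1 / eps ^+ 2 * (m%:R * log2 R m).
have log1 : 1 <= log2 R m by rewrite /log2 le_max lexx.
have ln2 : 0 < ln 2%:R :> R by rewrite ln_gt0 // ltr1n.
(* The natural logarithm is the smaller one because [ln 2 <= 1]. *)
have lnm : ln m%:R <= log2 R m.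
  have ln2le1 : ln 2%:R <= 1 :> R.
    by have := @le_ln1Dx R 1; rewrite -[2%:R]/(1 + 1); apply; lra.
  have lnm0 : 0 <= ln m%:R :> R by rewrite ln_ge0 // ler1n.
  rewrite /log2 le_max; apply/orP; right.
  by rewrite ler_pdivlMr // ler_piMr.
have epsV : 1 <= 1 / eps ^+ 2.
  by rewrite div1r invf_ge1 ?exprn_gt0 // exprn_ile1 // ltW.
have mR : 1 <= m%:R :> R by rewrite ler1n.
have mH : m%:R <= H.
  rewrite /H; apply: (@le_trans _ _ (1 * (m%:R * 1))); first by rewrite mul1r mulr1.
  by rewrite ler_pM // ?mulr_ge0 // ler_wpM2l.
(* The extra iteration is absorbed by [1 <= m <= H], which relies on the truncation of [log2] at
   1. *)
have TH : T%:R <= 5%:R * H.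
  apply: (le_trans TB); have -> : 5%:R * H = 4%:R * H + H by ring.
  rewrite lerD ?(le_trans mR) //.
  have -> : 4%:R * (m%:R * ln m%:R) / eps ^+ 2 = 4%:R * (1 / eps ^+ 2 * (m%:R * ln m%:R)).
    by field; rewrite gt_eqF.
  rewrite /H ler_wpM2l // ler_wpM2l ?(le_trans ler01) //.
  by rewrite ler_wpM2l.
have TA0 : 0 <= TA by apply: le_trans TAn; rewrite mulr_ge0 // ltW.
have H0 : 0 <= H by apply: le_trans mH.
have N0 : 0 <= (nnz A)%:R :> R by [].
rewrite /running_time.
have tR : t%:R <= 1000%:R * (m%:R * n%:R) + 5000%:R * (T%:R * (nnz A)%:R) :> R.
  by rewrite -!natrM -natrD ler_nat.
have mnB : m%:R * n%:R <= H * TA / kappa.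
  rewrite ler_pdivlMr // -mulrA ler_pM //.
    by rewrite mulr_ge0 // ltW.
  by rewrite mulrC.
have TNB : T%:R * (nnz A)%:R <= 5%:R * H * (nnz A)%:R by rewrite ler_wpM2r.
have TTAB : T%:R * TA <= 5%:R * H * TA by rewrite ler_wpM2r.
have KE : (1000%:R / kappa + 25000%:R) * (H * ((nnz A)%:R + TA)) =
    1000%:R * (H * TA / kappa) + 1000%:R * (H * (nnz A)%:R / kappa) +
    25000%:R * (H * (nnz A)%:R) + 25000%:R * (H * TA).
  by field; rewrite gt_eqF.
have HN0 : 0 <= H * (nnz A)%:R / kappa by apply: divr_ge0; [exact: mulr_ge0 | exact: ltW].
have HTA0 : 0 <= H * TA by rewrite mulr_ge0.
rewrite KE; lra.
Qed.
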